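(* Let $(M,\omega)$ be an $n$-dimensional compact Chern-Kähler-like Hermitian manifold with $\mathrm{Ric}_{k}(\omega)>0$ (resp. $\mathrm{Ric}_{k}(\omega)<0$) for some $k\in\{1,\ldots,n\}$. Then $(TM,\omega)$ is uniformly RC $k$-positive (resp. uniformly RC $k$-negative) over $(M,\omega)$.
   Context: $TM$ denotes the holomorphic tangent bundle and $T_xM$ the $(1,0)$-type tangent space at $x$. Chern curvature: for a Hermitian holomorphic vector bundle $(E,h)$ over a complex manifold $M$ with Chern connection $\nabla$, the Chern curvature tensor is $R^{(E,h)}=\nabla^2\in\Gamma(\Lambda^{1,1}M\otimes E^\ast\otimes E)$. For $X,Y\in T_xM$ and $u,v\in E_x$, $R_{X\overline{Y}}(u)\in E_x$ is obtained by evaluating the curvature $(1,1)$-form on $(X,\overline{Y})$ and applying it to $u$, and $R^{(E,h)}(X,\overline{Y},u,\overline{v}):=h\big(R_{X\overline{Y}}(u),v\big)$. For a Hermitian manifold $(M,\omega)$ write $R=R^{(TM,\omega)}$. Chern-Kähler-like: the Hermitian metric $\omega$ is called Chern-Kähler-like if $R(X,\overline{Y},Z,\overline{W})=R(Z,\overline{Y},X,\overline{W})$ for all $(1,0)$-type tangent vectors $X,Y,Z,W$. $k$-Ricci curvature: for $x\in M$, a $k$-dimensional complex subspace $\Sigma\subset T_xM$ with unitary basis $\{E_1,\ldots,E_k\}$, and $X\in\Sigma$, set $\mathrm{Ric}_k(x,\Sigma)(X,\overline{X}):=\sum_{i=1}^kR(X,\overline{X},E_i,\overline{E_i})$. One writes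 $\mathrm{Ric}_k(\omega)>0$ (resp. $<0$) if $\mathrm{Ric}_k(x,\Sigma)(X,\overline{X})>0$ (resp. $<0$) for every $x\in M$, every $k$-dimensional subspace $\Sigma\subset T_xM$ and every nonzero $X\in\Sigma$. Uniform RC $k$-positivity: a Hermitian holomorphic vector bundle $(E,h)$ over an $n$-dimensional Hermitian manifold $(M,\omega)$ is called uniformly RC $k$-positive (resp. uniformly RC $k$-negative), $1\leq k\leq n$, if for every $x\in M$ there exists a $k$-dimensional complex subspace $\Sigma\subset T_xM$ such that for every nonzero $u\in E_x$, $$R^{(E,h)}(\Sigma;u,\overline{u}):=\sum_{i=1}^kR^{(E,h)}(E_i,\overline{E_i},u,\overline{u})>0\quad(\text{resp. }<0),$$ where $\{E_1,\ldots,E_k\}$ is a unitary basis of $\Sigma$ with respect to $\omega$. Here it is applied with $E=TM$ and $h$ the Hermitian metric $\omega$. *)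

(* Defs.v *)
From HB Require Import structures.
From mathcomp Require Import all_boot all_order all_algebra.
From mathcomp Require Import complex.
From mathcomp Require Import all_classical all_reals all_analysis.
Import numFieldNormedType.Exports.
Import Order.TTheory GRing.Theory Num.Theory.

Set Implicit Arguments.
Unset Strict Implicit.
Unset Printing Implicit Defensive.

Local Open Scope classical_set_scope.
Local Open Scope ring_scope.
Local Open Scope sesquilinear_scope.

(* Keyed as a numClosedFieldType: the topology and the normed module structure
   over itself are then the generic ones of a numFieldType, whereas [R[i]] alone
   carries only an R-module structure. *)
Definition Cx (R : realType) : numClosedFieldType := complex R.

Lemma near_eq_differentiable (K : numFieldType) (V W : normedModType K)
    (f g : V -> W) (z : V) :
  (\near z, f z = g z) -> differentiable f z -> differentiable g z.
Proof.
move=> fg /diff_locallyP [cd /eqaddoP ed].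
have fg0 : \forall h \near (0 : V), f (h + z) = g (h + z).
  by move: fg; rewrite (near_shift 0); apply: filterS => h /=; rewrite subr0.
have dg : g \o shift z = cst (g z) + 'd f z +o_ 0 id.
  apply/eqaddoP => e e0; apply: filterS2 (ed e e0) fg0 => h.
  by rewrite !fctE /= => + fgh; rewrite -fgh (nbhs_singleton fg).
apply/diff_locallyP; rewrite (diff_unique cd dg).
by split.
Unshelve. all: by end_near. Qed.

(* Holomorphic functions of several complex variables: ['D_v f] over [K := Cx R]
   is the complex directional derivative.  By Cauchy's formula, one complex
   differentiation (k = 1) already gives all the others; all orders are required
   here so that no such theorem is needed to see that derivatives of
   holomorphic functions are holomorphic. *)
Section Holomorphic.
Context {K : numFieldType} {n : nat}.
Implicit Types (U : set 'rV[K]_n) (f g : 'rV[K]_n -> K).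

Fixpoint cdifferentiable (k : nat) U f : Prop :=
  if k is k'.+1 then
    (forall z, U z -> differentiable f z) /\
    (forall v, cdifferentiable k' U ('D_v f))
  else True.

Definition holomorphic U f : Prop := forall k, cdifferentiable k U f.

Lemma cdifferentiableS k U f : cdifferentiable k.+1 U f -> cdifferentiable k U f.
Proof.
by elim: k f => // k IH f [df Df]; split=> // v; exact/IH/Df.
Qed.

Lemma sub_cdifferentiable k U V f :
  V `<=` U -> cdifferentiable k U f -> cdifferentiable k V f.
Proof.
move=> VU; elim: k f => // k IH f [df Df]; split=> [z /VU|v]; first exact: df.
exact/IH/Df.
Qed.

Lemma eq_cdifferentiable k U f g : open U -> (forall z, U z -> f z = g z) ->
  cdifferentiable k U f -> cdifferentiable k U g.
Proof.
move=> Uo; elim: k f g => // k IH f g fg [df Df].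
have nfg z : U z -> \near z, f z = g z.
  move=> Uz; near=> w; apply: fg; near: w; exact: open_nbhs_nbhs.
split=> [z Uz|v]; first exact: near_eq_differentiable (nfg z Uz) (df z Uz).
by apply: (IH ('D_v f)) (Df v) => z Uz; exact/near_eq_derive/nfg.
Unshelve. all: by end_near. Qed.

Lemma cdifferentiable_cst k U (c : K) : cdifferentiable k U (cst c).
Proof.
elim: k c => // k IH c; split=> [z _|v]; first exact: differentiable_cst.
rewrite (_ : 'D_v (cst c) = cst 0) ?funeqE//; move=> z; exact: derive_cst.
Qed.

Lemma cdifferentiableD k U f g : open U ->
  cdifferentiable k U f -> cdifferentiable k U g -> cdifferentiable k U (f + g).
Proof.
move=> Uo; elim: k f g => // k IH f g [df Df] [dg Dg].
split=> [z Uz|v]; first exact: differentiableD (df z Uz) (dg z Uz).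
apply: (eq_cdifferentiable Uo _ (IH _ _ (Df v) (Dg v))) => z Uz.
by rewrite deriveD//; [exact/diff_derivable/df|exact/diff_derivable/dg].
Qed.

Lemma cdifferentiableM k U f g : open U ->
  cdifferentiable k U f -> cdifferentiable k U g -> cdifferentiable k U (f * g).
Proof.
move=> Uo; elim: k f g => // k IH f g Hf Hg.
have [[df Df] [dg Dg]] := (Hf, Hg).
split=> [z Uz|v]; first exact: differentiableM (df z Uz) (dg z Uz).
have DM : cdifferentiable k U (f * 'D_v g + g * 'D_v f).
  exact: (cdifferentiableD Uo (IH _ _ (cdifferentiableS Hf) (Dg v))
                              (IH _ _ (cdifferentiableS Hg) (Df v))).
apply: (eq_cdifferentiable Uo _ DM) => z Uz.
by rewrite deriveM//; [exact/diff_derivable/df|exact/diff_derivable/dg].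
Qed.

Lemma cdifferentiable_sum k U (I : Type) (s : seq I) (F : I -> 'rV[K]_n -> K) :
  open U -> (forall i, cdifferentiable k U (F i)) ->
  cdifferentiable k U (\sum_(i <- s) F i).
Proof.
move=> Uo HF; elim/big_ind: _ => //; first exact: cdifferentiable_cst.
by move=> f g; exact: cdifferentiableD.
Qed.

End Holomorphic.

Section HolomorphicMap.
Context {K : numFieldType} {n m : nat}.
Implicit Types (U : set 'rV[K]_n) (g : 'rV[K]_n -> 'rV[K]_m).

Definition holomorphic_map U g : Prop := forall j, holomorphic U (fun z => g z 0 j).

Definition jacobianC g (z : 'rV[K]_n) : 'M[K]_(n, m) :=
  \matrix_(i, j) 'D_(delta_mx 0 i) (fun w => g w 0 j) z.

Lemma differentiable_row g z :
  (forall j, differentiable (fun z => g z 0 j) z) -> differentiable g z.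
Proof.
move=> dg; rewrite (_ : g = \sum_j (fun z => g z 0 j *: delta_mx 0 j)); last first.
  by apply/funext => w; rewrite fct_sumE [LHS]row_sum_delta.
by apply: differentiable_sum => j; exact: differentiableZl.
Qed.

Lemma derive_row g z v j :
  differentiable g z -> ('D_v g z) 0 j = 'D_v (fun z => g z 0 j) z.
Proof.
move=> dg; pose p : 'rV[K]_m -> K := fun N => N 0 j.
have dp : differentiable p (g z) := differentiable_coord (g z) 0 j.
have pl : linear p by move=> a u w; rewrite /p !mxE.
pose plM := GRing.isLinear.Build _ _ _ _ p pl.
pose pL : {linear _ -> _} := HB.pack p plM.
have dpE : 'd p (g z) = p :> (_ -> _).
  by rewrite -[p]/(pL : _ -> _) diff_lin//; exact: coord_continuous.
rewrite -[fun z => g z 0 j]/(p \o g) !deriveE//; last exact: differentiable_comp.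
by rewrite [in RHS](diff_comp dg dp) [RHS]/comp dpE.
Qed.

Lemma derive_comp_row (f : 'rV[K]_m -> K) g z v :
    (forall j, differentiable (fun z => g z 0 j) z) -> differentiable f (g z) ->
  'D_v (f \o g) z =
  \sum_j 'D_v (fun z => g z 0 j) z * 'D_(delta_mx 0 j) f (g z).
Proof.
move=> dgj df; have dg := differentiable_row dgj.
rewrite deriveE; last exact: differentiable_comp.
rewrite diff_comp//= -(deriveE _ dg) [X in 'd f _ X]row_sum_delta linear_sum.
by apply: eq_bigr => j _; rewrite linearZ/= -(deriveE _ df) derive_row.
Qed.

End HolomorphicMap.

Lemma cdifferentiable_comp (K : numFieldType) n m k (U : set 'rV[K]_n)
    (V : set 'rV[K]_m) (f : 'rV[K]_m -> K) (g : 'rV[K]_n -> 'rV[K]_m) :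
    open U -> (forall z, U z -> V (g z)) ->
    (forall j, cdifferentiable k U (fun z => g z 0 j)) ->
  cdifferentiable k V f -> cdifferentiable k U (f \o g).
Proof.
move=> Uo UV; elim: k f => // k IH f Hg [df Df].
have dg z j : U z -> differentiable (fun z => g z 0 j) z.
  by move=> Uz; exact: (Hg j).1.
split=> [z Uz|v].
  apply: differentiable_comp; last exact/df/UV.
  by apply: differentiable_row => j; exact: dg.
have DC : cdifferentiable k U (\sum_j
    ('D_v (fun z => g z 0 j) * ('D_(delta_mx 0 j) f \o g))).
  apply: (cdifferentiable_sum _ Uo) => j; apply: (cdifferentiableM Uo).
    exact: (Hg j).2.
  by apply: IH => [i|]; [exact/cdifferentiableS/Hg|exact: Df].
apply: (eq_cdifferentiable Uo _ DC) => z Uz.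
rewrite derive_comp_row//; [|by move=> j; exact: dg|exact/df/UV].
by rewrite fct_sumE.
Qed.

Record complexManifold (R : realType) (n : nat) := ComplexManifold {
  cm_space :> topologicalType;
  cm_hausdorff : hausdorff_space cm_space;
  cm_second_countable : @second_countable cm_space;
  cm_index : Type;
  cm_dom : cm_index -> set cm_space;
  cm_chart : cm_index -> cm_space -> 'rV[Cx R]_n;
  cm_inv : cm_index -> 'rV[Cx R]_n -> cm_space;
  (* a preferred chart around each point *)
  cm_at : cm_space -> cm_index;
  cm_dom_open : forall a, open (cm_dom a);
  cm_img_open : forall a, open (cm_chart a @` cm_dom a);
  cm_chart_continuous : forall a x, cm_dom a x -> {for x, continuous (cm_chart a)};
  cm_inv_continuous : forall a z, (cm_chart a @` cm_dom a) z ->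
    {for z, continuous (cm_inv a)};
  cm_chartK : forall a x, cm_dom a x -> cm_inv a (cm_chart a x) = x;
  cm_at_dom : forall x, cm_dom (cm_at x) x;
  cm_transition : forall a b,
    holomorphic_map (cm_chart a @` (cm_dom a `&` cm_dom b))
                    (fun z => cm_chart b (cm_inv a z))
}.

Section FunctionsOnManifolds.
Context {R : realType} {n : nat}.
Implicit Types (U : set 'rV[Cx R]_n) (f : 'rV[Cx R]_n -> Cx R)
  (z v : 'rV[Cx R]_n).

Definition line z v (t : R) : 'rV[Cx R]_n := z + (t%:C%C : Cx R) *: v.

(* Derivative in the real sense, along the real vector underlying [v]. *)
Definition rderivable f v z : Prop :=
  derivable (fun t : R => complex.Re (f (line z v t))) 0 1 /\
  derivable (fun t : R => complex.Im (f (line z v t))) 0 1.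

Definition rderive f v z : Cx R :=
  Complex ('D_1 (fun t : R => complex.Re (f (line z v t))) 0)
          ('D_1 (fun t : R => complex.Im (f (line z v t))) 0).

Fixpoint rsmooth (k : nat) U f : Prop :=
  (forall z, U z -> {for z, continuous f}) /\
  (if k is k'.+1 then
     forall v, (forall z, U z -> rderivable f v z) /\ rsmooth k' U (rderive f v)
   else True).

Definition smooth U f : Prop := forall k, rsmooth k U f.

Definition holomorphic_on (M : complexManifold R n) (A : set M) (f : M -> Cx R) :=
  forall c, holomorphic (cm_chart c @` (A `&` cm_dom c)) (f \o cm_inv c).

Definition smooth_on (M : complexManifold R n) (A : set M) (f : M -> Cx R) :=
  forall c, smooth (cm_chart c @` (A `&` cm_dom c)) (f \o cm_inv c).

End FunctionsOnManifolds.

(* A holomorphic vector bundle of rank r, given by its transition matrices.  An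
   element of the fibre over [x] has, in the trivialization [a], a row vector
   [u_a] of coordinates with respect to the local holomorphic frame, and
   [u_b = u_a *m hb_trans a b x]. *)
Record holBundle (R : realType) (n : nat) (M : complexManifold R n) (r : nat) :=
  HolBundle {
  hb_index : Type;
  hb_dom : hb_index -> set M;
  (* a preferred trivialization around each point *)
  hb_at : M -> hb_index;
  hb_trans : hb_index -> hb_index -> M -> 'M[Cx R]_r;
  hb_dom_open : forall a, open (hb_dom a);
  hb_at_dom : forall x, hb_dom (hb_at x) x;
  hb_trans_holomorphic : forall a b i j,
    holomorphic_on (hb_dom a `&` hb_dom b) (fun x => hb_trans a b x i j);
  hb_trans_id : forall a x, hb_dom a x -> hb_trans a a x = 1%:M;
  hb_cocycle : forall a b c x, hb_dom a x -> hb_dom b x -> hb_dom c x ->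
    hb_trans a b x *m hb_trans b c x = hb_trans a c x
}.

Section TangentBundle.
Context {R : realType} {n : nat} (M : complexManifold R n).
Implicit Types (a b c : cm_index M) (x : M).

(* In the holomorphic frame [d/dz_1, ..., d/dz_n] of a chart. *)
Definition tb_trans a b x : 'M[Cx R]_n :=
  jacobianC (fun z => cm_chart b (cm_inv a z)) (cm_chart a x).

Lemma open_chart_image c (A : set M) : open A ->
  open (cm_chart c @` (A `&` cm_dom c)).
Proof.
move=> Ao; rewrite openE => _ [x [Ax cx] <-].
have zc : (cm_chart c @` cm_dom c) (cm_chart c x) by exists x.
have nc : nbhs (cm_chart c x) (cm_chart c @` cm_dom c).
  by apply: open_nbhs_nbhs; split=> //; exact: cm_img_open.
have nA : nbhs (cm_chart c x) (cm_inv c @^-1` A).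
  apply: (cm_inv_continuous zc); rewrite cm_chartK//.
  exact: open_nbhs_nbhs.
apply: filterS2 nc nA => _ [y cy <-]; rewrite /= cm_chartK// => Ay.
by exists y.
Qed.

Lemma tb_trans_holomorphic a b i j :
  holomorphic_on (cm_dom a `&` cm_dom b) (fun x => tb_trans a b x i j).
Proof.
move=> c k.
have Uo : open (cm_chart c @` ((cm_dom a `&` cm_dom b) `&` cm_dom c)).
  by apply: open_chart_image; apply: openI; exact: cm_dom_open.
pose F (z : 'rV[Cx R]_n) := 'D_(delta_mx 0 i) (fun w => cm_chart b (cm_inv a w) 0 j) z.
rewrite (_ : _ \o _ = F \o (fun z => cm_chart a (cm_inv c z))); last first.
  by apply/funext => z; rewrite /= mxE.
apply: (@cdifferentiable_comp _ _ _ _ _ (cm_chart a @` (cm_dom a `&` cm_dom b))) => //.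
- by move=> _ [x [[ax bx] cx] <-]; rewrite cm_chartK//; exists x.
- move=> l; apply: sub_cdifferentiable (cm_transition c a l k).
  by move=> _ [x [[ax bx] cx] <-]; exists x.
- exact: (cm_transition a b j k.+1).2.
Qed.

Lemma tb_trans_id a x : cm_dom a x -> tb_trans a a x = 1%:M.
Proof.
move=> ax; apply/matrixP => i j; rewrite !mxE.
rewrite (@near_eq_derive _ _ _ _ (fun w : 'rV[Cx R]_n => id w 0 j)).
  by rewrite -derive_row// derive_id mxE eqxx eq_sym.
have : nbhs (cm_chart a x) (cm_chart a @` cm_dom a).
  by apply: open_nbhs_nbhs; split; [exact: cm_img_open|exists x].
by apply: filterS => _ [y ay <-]; rewrite cm_chartK.
Qed.

Lemma tb_cocycle a b c x : cm_dom a x -> cm_dom b x -> cm_dom c x ->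
  tb_trans a b x *m tb_trans b c x = tb_trans a c x.
Proof.
move=> ax bx cx; have xK := cm_chartK ax; apply/matrixP => i j.
have dg l : differentiable (fun z => cm_chart b (cm_inv a z) 0 l) (cm_chart a x).
  by apply: (cm_transition a b l 1).1; exists x.
have df : differentiable (fun z => cm_chart c (cm_inv b z) 0 j)
    (cm_chart b (cm_inv a (cm_chart a x))).
  by rewrite xK; apply: (cm_transition b c j 1).1; exists x.
have E := derive_comp_row (delta_mx 0 i) dg df.
rewrite [LHS]mxE [RHS]mxE.
transitivity ('D_(delta_mx 0 i) ((fun z => cm_chart c (cm_inv b z) 0 j) \o
    (fun z => cm_chart b (cm_inv a z))) (cm_chart a x)).
  rewrite E; apply: eq_bigr => l _; congr (_ * _); first exact: mxE.
  by rewrite xK; exact: mxE.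
apply: near_eq_derive.
have : nbhs (cm_chart a x) (cm_chart a @` (cm_dom b `&` cm_dom a)).
  apply: open_nbhs_nbhs; split; last by exists x.
  exact/open_chart_image/cm_dom_open.
apply: filterS => _ [y [yb ya] <-].
by rewrite /= (cm_chartK ya) (cm_chartK yb).
Qed.

Definition tangentBundle : holBundle M n :=
  HolBundle (@cm_dom_open _ _ M) (@cm_at_dom _ _ M)
    tb_trans_holomorphic tb_trans_id tb_cocycle.

End TangentBundle.

Definition herm {R : realType} {r : nat} (H : 'M[Cx R]_r) (u v : 'rV[Cx R]_r)
  : Cx R := (u *m H *m v ^t*) 0 0.

(* [hm_mx a x] is the Gram matrix of the frame [a] at [x]. *)
Record hermMetric (R : realType) (n : nat) (M : complexManifold R n) (r : nat)
    (E : holBundle M r) := HermMetric {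
  hm_mx : hb_index E -> M -> 'M[Cx R]_r;
  hm_smooth : forall a i j, smooth_on (hb_dom a) (fun x => hm_mx a x i j);
  hm_herm : forall a x, hb_dom a x -> (hm_mx a x) ^t* = hm_mx a x;
  hm_pos : forall a x u, hb_dom a x -> u != 0 -> 0 < herm (hm_mx a x) u u;
  hm_compat : forall a b x, hb_dom a x -> hb_dom b x ->
    hm_mx a x = hb_trans a b x *m hm_mx b x *m (hb_trans a b x) ^t*
}.

(* The Chern connection in a local holomorphic frame with Gram matrix [h], over
   an open set of C^n.  Sections are row vectors of coefficients; [X] and [Y]
   stand for the vector fields sum_i X_i d/dz_i and sum_i Y_i d/dz_i with
   constant coefficients. *)
Section LocalChern.
Context {R : realType} {n r : nat}.
Implicit Types (X Y z : 'rV[Cx R]_n) (s : 'rV[Cx R]_n -> 'rV[Cx R]_r)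
  (h : 'rV[Cx R]_n -> 'M[Cx R]_r).

(* sum_i X_i df/dz_i and sum_i conj(Y_i) df/dzbar_i *)
Definition del X (f : 'rV[Cx R]_n -> Cx R) z : Cx R :=
  (rderive f X z - 'i * rderive f ('i *: X) z) / 2.
Definition delbar Y (f : 'rV[Cx R]_n -> Cx R) z : Cx R :=
  (rderive f Y z + 'i * rderive f ('i *: Y) z) / 2.

Definition del_mx p q X (A : 'rV[Cx R]_n -> 'M[Cx R]_(p, q)) z : 'M[Cx R]_(p, q) :=
  \matrix_(i, j) del X (fun w => A w i j) z.
Definition delbar_mx p q Y (A : 'rV[Cx R]_n -> 'M[Cx R]_(p, q)) z
  : 'M[Cx R]_(p, q) :=
  \matrix_(i, j) delbar Y (fun w => A w i j) z.

(* The connection is of type (1,0) in a holomorphic frame and its form theta is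
   determined by metric compatibility, [del_mx X h = theta X *m h]. *)
Definition chern_form h X z : 'M[Cx R]_r := del_mx X h z *m invmx (h z).

Definition nabla h X s z : 'rV[Cx R]_r := del_mx X s z + s z *m chern_form h X z.
Definition nablabar Y s z : 'rV[Cx R]_r := delbar_mx Y s z.

(* [X] and [Ybar] commute, so that nabla^2 (X, Ybar) is the commutator of the
   two covariant derivatives; it is tensorial in the section, here the one with
   constant coefficients [u]. *)
Definition chern_curvature h X Y (u : 'rV[Cx R]_r) z : 'rV[Cx R]_r :=
  nabla h X (nablabar Y (cst u)) z - nablabar Y (nabla h X (cst u)) z.

End LocalChern.

Section Curvature.
Context {R : realType} {n : nat} {M : complexManifold R n}.

(* From here on, elements of a fibre over [x] are given by their coordinates in
   the preferred trivialization at [x]; for the tangent bundle this is the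
   preferred chart at [x]. *)
Definition metric_at r (E : holBundle M r) (h : hermMetric E) (x : M)
    (u v : 'rV[Cx R]_r) : Cx R :=
  herm (hm_mx h (hb_at E x) x) u v.

(* [metric_at h x (R_{X Ybar} u) v], i.e. R^(E,h)(X, Ybar, u, vbar) *)
Definition curvature r (E : holBundle M r) (h : hermMetric E) (x : M)
    (X Y : 'rV[Cx R]_n) (u v : 'rV[Cx R]_r) : Cx R :=
  metric_at h x
    (chern_curvature (fun z => hm_mx h (hb_at E x) (cm_inv (cm_at x) z)) X Y u
      (cm_chart (cm_at x) x))
    v.

Variable omega : hermMetric (tangentBundle M).

Definition chern_kahler_like : Prop := forall x X Y Z W,
  curvature omega x X Y Z W = curvature omega x Z Y X W.

Definition unitary_basis k (x : M) (S : {vspace 'rV[Cx R]_n})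
    (e : k.-tuple 'rV[Cx R]_n) : Prop :=
  basis_of S e /\
  forall i j, metric_at omega x (tnth e i) (tnth e j) = (i == j)%:R.

(* Ric_k(x, S)(X, Xbar), computed with the unitary basis [e] of S *)
Definition ric k (x : M) (e : k.-tuple 'rV[Cx R]_n) (X : 'rV[Cx R]_n) : Cx R :=
  \sum_(i < k) curvature omega x X X (tnth e i) (tnth e i).

(* In [Cx R], [0 < w] means that w is real and positive. *)
Definition ric_pos (k : nat) : Prop :=
  forall x (S : {vspace 'rV[Cx R]_n}), \dim S = k ->
  forall e : k.-tuple _, unitary_basis x S e ->
  forall X, X \in S -> X != 0 -> 0 < ric x e X.

Definition ric_neg (k : nat) : Prop :=
  forall x (S : {vspace 'rV[Cx R]_n}), \dim S = k ->
  forall e : k.-tuple _, unitary_basis x S e ->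
  forall X, X \in S -> X != 0 -> ric x e X < 0.

Section UniformRC.
Context {r : nat} {E : holBundle M r} (h : hermMetric E).

(* R^(E,h)(S; u, ubar), computed with the unitary basis [e] of S *)
Definition rc_sum k (x : M) (e : k.-tuple 'rV[Cx R]_n) (u : 'rV[Cx R]_r) : Cx R :=
  \sum_(i < k) curvature h x (tnth e i) (tnth e i) u u.

Definition uniformly_RC_pos (k : nat) : Prop :=
  forall x, exists S : {vspace 'rV[Cx R]_n}, \dim S = k /\
  forall e : k.-tuple _, unitary_basis x S e ->
  forall u, u != 0 -> 0 < rc_sum x e u.

Definition uniformly_RC_neg (k : nat) : Prop :=
  forall x, exists S : {vspace 'rV[Cx R]_n}, \dim S = k /\
  forall e : k.-tuple _, unitary_basis x S e ->
  forall u, u != 0 -> rc_sum x e u < 0.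

End UniformRC.
End Curvature.

(* Main.v *)
Require Import Defs.
From mathcomp Require Import all_boot all_order all_algebra.
From mathcomp Require Import complex ring lra.
From mathcomp Require Import all_classical all_reals all_analysis.
Import numFieldNormedType.Exports.
Import Order.TTheory GRing.Theory Num.Theory.

Set Implicit Arguments.
Unset Strict Implicit.
Unset Printing Implicit Defensive.

Local Open Scope classical_set_scope.
Local Open Scope ring_scope.
Local Open Scope sesquilinear_scope.

(** The statement is pointwise.  Fix a point x and write Q(X, Y, Z, W) for
    R(X, Ybar, Z, Wbar) there, and g for the metric.  Two symmetries of Q drive
    everything: the Chern-Kaehler-like hypothesis exchanges X and Z, and Q is
    Hermitian, i.e. conjugation exchanges (X, Z) with (Y, W).  The second one is
    a fact about Chern curvature: in a holomorphic frame with Gram matrix h,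
    Q(X, Y, u, v) = - u K(X, Y) v^* with
      K(X, Y) = delbar_Y del_X h - (del_X h) h^-1 (delbar_Y h),
    and K(X, Y)^* = K(Y, X) because h is Hermitian and second derivatives
    commute ([chern_matrix_adjoint], resting on [rderive_comm]).  Linearity in u
    and the two symmetries make Q sesquilinear in all its arguments
    ([curvature_kahler_tensor]).

    Suppose now Ric_k > 0.  Among the orthonormal k-frames e at x, which form a
    compact set, choose one that minimizes the k-scalar curvature
      T(e) = sum_(i, j) Q(e_i, e_i, e_j, e_j)
    ([exists_minimal_frame]); its span is the required subspace.  To see this,
    let F be orthogonal to the frame and replace e_m by the normalization of
    e_m + t F, with t real.  Multiplied by (1 + t^2 g(F, F))^2, the variation of
    T is a nonnegative polynomial of degree 4 in t vanishing at 0, so its linear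
    coefficient is zero and its quadratic one is nonnegative.  Using F and i F
    together, the linear terms give
      sum_j Q(F, e_m, e_j, e_j) = 0                    ([ric_form_cross]),
    and the quadratic ones, in which the terms of type Q(F, e_m, F, e_m) cancel,
      g(F, F) sum_j Q(e_m, e_m, e_j, e_j)
        <= Q(F, F, e_m, e_m) + sum_j Q(F, F, e_j, e_j) ([ric_form_second]).
    Summing over m yields
      g(F, F) T(e) <= (k + 1) sum_j Q(F, F, e_j, e_j),
    where T(e) > 0 as a sum of k-Ricci curvatures.  Decompose a vector u into
    its projection P to the span and an orthogonal F: in
    sum_j Q(u, u, e_j, e_j) the cross terms vanish, the term in P is a k-Ricci
    curvature and the term in F has just been bounded below
    ([minimal_frame_pos]).  By the symmetries of Q this sum is
    sum_j Q(e_j, e_j, u, u), and it is a trace over the span, hence the same for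
    every unitary basis ([trace_change_frame]).  The negative case is the
    positive one for - Q, which has the same symmetries. *)

(** * Tensors with the symmetries of a Kaehler curvature tensor *)

Section KahlerTensor.
Context {C : numClosedFieldType} {V : lmodType C}.
Implicit Types (X Y Z W : V) (Q : V -> V -> V -> V -> C).

(** The arguments in second and fourth position are the barred ones.  Linearity
    in a single argument is enough: the two symmetries carry it to the other
    unbarred argument and, conjugated, to the barred ones. *)
Record kahler_tensor Q : Prop := KahlerTensor {
  kt_linear : forall X Y a Z Z' W,
    Q X Y (a *: Z + Z') W = a * Q X Y Z W + Q X Y Z' W;
  kt_conj : forall X Y Z W, (Q X Y Z W)^* = Q Y X W Z;
  kt_sym : forall X Y Z W, Q X Y Z W = Q Z Y X W
}.

Lemma kahler_tensorN Q :
  kahler_tensor Q -> kahler_tensor (fun X Y Z W => - Q X Y Z W).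
Proof.
move=> QK; split=> *; first by rewrite (kt_linear QK) opprD mulrN.
  by rewrite rmorphN /= (kt_conj QK).
by rewrite (kt_sym QK).
Qed.

Context {Q : V -> V -> V -> V -> C} (QK : kahler_tensor Q).

Lemma kt_sym24 X Y Z W : Q X Y Z W = Q X W Z Y.
Proof. by rewrite -(kt_conj QK) (kt_sym QK) (kt_conj QK). Qed.

Lemma kt0 X Y W : Q X Y 0 W = 0.
Proof.
have := kt_linear QK X Y 1 0 0 W.
by rewrite scale1r addr0 mul1r => /esym /(canRL (addrK _)); rewrite subrr.
Qed.

Lemma kt_add3 X Y Z Z' W : Q X Y (Z + Z') W = Q X Y Z W + Q X Y Z' W.
Proof. by rewrite -[Z in Z + _]scale1r (kt_linear QK) mul1r. Qed.

Lemma kt_scale3 X Y a Z W : Q X Y (a *: Z) W = a * Q X Y Z W.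
Proof. by rewrite -[a *: Z]addr0 (kt_linear QK) kt0 addr0. Qed.

Lemma kt_add1 X X' Y Z W : Q (X + X') Y Z W = Q X Y Z W + Q X' Y Z W.
Proof. by rewrite !(kt_sym QK _ Y Z) kt_add3. Qed.

Lemma kt_scale1 X Y a Z W : Q (a *: X) Y Z W = a * Q X Y Z W.
Proof. by rewrite !(kt_sym QK _ Y Z) kt_scale3. Qed.

Lemma kt_add2 X Y Y' Z W : Q X (Y + Y') Z W = Q X Y Z W + Q X Y' Z W.
Proof. by rewrite -(kt_conj QK) kt_add1 rmorphD/= !(kt_conj QK). Qed.

Lemma kt_scale2 X Y a Z W : Q X (a *: Y) Z W = a^* * Q X Y Z W.
Proof. by rewrite -(kt_conj QK) kt_scale1 rmorphM/= !(kt_conj QK). Qed.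

Lemma kt_add4 X Y Z W W' : Q X Y Z (W + W') = Q X Y Z W + Q X Y Z W'.
Proof. by rewrite !(kt_sym24 X Y) kt_add2. Qed.

Lemma kt_scale4 X Y a Z W : Q X Y Z (a *: W) = a^* * Q X Y Z W.
Proof. by rewrite !(kt_sym24 X Y) kt_scale2. Qed.

Lemma kt_swap X Y Z W : Q X Y Z W = Q Z W X Y.
Proof. by rewrite (kt_sym QK) kt_sym24. Qed.

Lemma kt_suml I (r : seq I) (P : pred I) (F : I -> V) Y Z W :
  Q (\sum_(i <- r | P i) F i) Y Z W = \sum_(i <- r | P i) Q (F i) Y Z W.
Proof.
apply: (big_morph (fun X => Q X Y Z W)) => [X X'|]; first exact: kt_add1.
by rewrite (kt_sym QK) kt0.
Qed.

Lemma kt_sumr I (r : seq I) (P : pred I) (F : I -> V) X Z W :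
  Q X (\sum_(i <- r | P i) F i) Z W = \sum_(i <- r | P i) Q X (F i) Z W.
Proof.
rewrite -(kt_conj QK) kt_suml rmorph_sum/=.
by apply: eq_bigr => i _; exact: (kt_conj QK).
Qed.

(** The quadratic coefficient comes from choosing which two of the four slots
    receive Y: the four choices of one barred and one unbarred slot agree by
    symmetry, and the two remaining ones are the (2,0) and (0,2) terms. *)
Lemma kt_quartic X Y (t : C) : t^* = t ->
  let Z := X + t *: Y in
  Q Z Z Z Z = Q X X X X + t * (2 * (Q Y X X X + Q X Y X X))
    + t ^+ 2 * (4 * Q Y Y X X + Q Y X Y X + Q X Y X Y)
    + t ^+ 3 * (2 * (Q Y Y Y X + Q Y Y X Y)) + t ^+ 4 * Q Y Y Y Y.
Proof.
move=> tR /=.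
rewrite !(kt_add1, kt_add2, kt_add3, kt_add4).
rewrite !(kt_scale1, kt_scale2, kt_scale3, kt_scale4) !tR.
rewrite (kt_sym QK X X Y X) (kt_sym24 X X X Y).
rewrite (kt_sym QK X X Y Y) (kt_sym24 Y X X Y) (kt_sym QK X Y Y X).
rewrite (kt_sym24 Y X Y Y) (kt_sym QK X Y Y Y).
ring.
Qed.

End KahlerTensor.
(** * Inner products and orthonormal frames *)

Section Frames.
Context {C : numClosedFieldType} {V : lmodType C}.
Implicit Types (X Y Z W : V) (g : V -> V -> C).

Record inner_product g : Prop := InnerProduct {
  ip_linear : forall a X Y Z, g (a *: X + Y) Z = a * g X Z + g Y Z;
  ip_conj : forall X Y, (g X Y)^* = g Y X;
  ip_pos : forall X, X != 0 -> 0 < g X X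
}.

Definition orthonormal g k (e : 'I_k -> V) : Prop :=
  forall i j, g (e i) (e j) = (i == j)%:R.

Context {g : V -> V -> C} (gP : inner_product g).

Lemma ip0l Y : g 0 Y = 0.
Proof.
have := ip_linear gP 1 0 0 Y.
by rewrite scale1r addr0 mul1r => /esym /(canRL (addrK _)); rewrite subrr.
Qed.

Lemma ipDl X X' Y : g (X + X') Y = g X Y + g X' Y.
Proof. by rewrite -[X in X + _]scale1r (ip_linear gP) mul1r. Qed.

Lemma ipZl a X Y : g (a *: X) Y = a * g X Y.
Proof. by rewrite -[a *: X]addr0 (ip_linear gP) ip0l addr0. Qed.

Lemma ipDr X Y Y' : g X (Y + Y') = g X Y + g X Y'.
Proof. by rewrite -(ip_conj gP) ipDl rmorphD/= !(ip_conj gP). Qed.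

Lemma ipZr a X Y : g X (a *: Y) = a^* * g X Y.
Proof. by rewrite -(ip_conj gP) ipZl rmorphM/= !(ip_conj gP). Qed.

Lemma ip_suml I (r : seq I) (P : pred I) (F : I -> V) Y :
  g (\sum_(i <- r | P i) F i) Y = \sum_(i <- r | P i) g (F i) Y.
Proof.
by apply: (big_morph (g ^~ Y)) => [X X'|]; [exact: ipDl|exact: ip0l].
Qed.

Lemma ip_ge0 X : 0 <= g X X.
Proof.
by have [->|/(ip_pos gP)/ltW//] := eqVneq X 0; rewrite ip0l.
Qed.

Lemma ip_real X : (g X X)^* = g X X.
Proof. exact: (ip_conj gP). Qed.

Lemma ip_eq0 X Y : (g X Y == 0) = (g Y X == 0).
Proof. by rewrite -(ip_conj gP) conjC_eq0. Qed.

Lemma bessel1 X Y : g X X = 1 -> `|g X Y| ^+ 2 <= g Y Y.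
Proof.
move=> X1; have := ip_ge0 (Y + (- g Y X) *: X).
rewrite !(ipDl, ipDr, ipZl, ipZr) X1 rmorphN/= (ip_conj gP).
rewrite (_ : _ + _ = g Y Y - g X Y * g Y X); last by ring.
by rewrite subr_ge0 normCK (ip_conj gP).
Qed.

Definition proj k (e : 'I_k -> V) X := \sum_i g X (e i) *: e i.

Lemma proj_orthogonal k (e : 'I_k -> V) X j :
  orthonormal g e -> g (X - proj e X) (e j) = 0.
Proof.
move=> eo; rewrite ipDl -scaleN1r ipZl ip_suml (bigD1 j)//=.
rewrite big1 => [|i ij]; first by rewrite ipZl eo eqxx mulr1 addr0 mulN1r subrr.
by rewrite ipZl eo (negPf ij) mulr0.
Qed.

Lemma orthonormal_neq0 k (e : 'I_k -> V) i : orthonormal g e -> e i != 0.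
Proof.
move=> eo; apply: contra_eq_neq (eo i i) => ->; rewrite ip0l eqxx eq_sym.
exact: oner_neq0.
Qed.

Section Trace.
Context {k : nat} {e e' : 'I_k -> V}.

(** The matrix A expressing e' in e satisfies A A^* = 1, hence also A^* A = 1,
    and the entries of A^* A are the coefficients of the B (e j) (e l) in the
    left-hand side. *)
Lemma trace_change_frame (B : V -> V -> C) :
    orthonormal g e -> orthonormal g e' ->
    (forall i, exists c : 'I_k -> C, e' i = \sum_j c j *: e j) ->
    (forall a X Y Z, B (a *: X + Y) Z = a * B X Z + B Y Z) ->
    (forall a X Y Z, B Z (a *: X + Y) = a^* * B Z X + B Z Y) ->
  \sum_i B (e' i) (e' i) = \sum_i B (e i) (e i).
Proof.
move=> eo eo' span Bl Br.
have Bl0 Z : B 0 Z = 0.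
  have := Bl 1 0 0 Z.
  by rewrite scale1r addr0 mul1r => /esym /(canRL (addrK _)); rewrite subrr.
have Br0 Z : B Z 0 = 0.
  have := Br 1 0 0 Z; rewrite scale1r addr0 rmorph1 mul1r.
  by move=> /esym /(canRL (addrK _)); rewrite subrr.
have BlS (c : 'I_k -> C) Z : B (\sum_j c j *: e j) Z = \sum_j c j * B (e j) Z.
  apply: (big_rec2 (fun x y => B x Z = y)) => // j x y _ <-.
  exact: Bl.
have BrS (c : 'I_k -> C) Z :
    B Z (\sum_j c j *: e j) = \sum_j (c j)^* * B Z (e j).
  apply: (big_rec2 (fun x y => B Z x = y)) => // j x y _ <-.
  exact: Br.
have [A Ae] := boolp.choice span.
pose M : 'M[C]_k := \matrix_(i, j) A i j.
have M1 : M *m M ^t* = 1%:M.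
  apply/matrixP => i j; rewrite !mxE -eo' !Ae ip_suml.
  apply: eq_bigr => l _; rewrite ipZl -(ip_conj gP) ip_suml (bigD1 l)//=.
  rewrite ipZl eo eqxx big1 => [|l' ll']; last first.
    by rewrite ipZl eo (negPf ll') mulr0.
  by rewrite !mxE addr0 mulr1.
have AA l j : \sum_i (A i l)^* * A i j = (l == j)%:R.
  have /matrixP/(_ l j) := mulmx1C M1; rewrite !mxE => <-.
  by apply: eq_bigr => i _; rewrite !mxE.
transitivity (\sum_j \sum_l (\sum_i (A i l)^* * A i j) * B (e j) (e l)).
  under [RHS]eq_bigr do under eq_bigr do rewrite mulr_suml.
  under [RHS]eq_bigr do rewrite exchange_big/=.
  rewrite exchange_big/=; apply: eq_bigr => i _.
  rewrite !Ae BlS; apply: eq_bigr => j _; rewrite BrS mulr_sumr.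
  by apply: eq_bigr => l _; ring.
apply: eq_bigr => j _; rewrite (bigD1 j)//= AA eqxx mul1r.
rewrite [X in _ + X]big1 ?addr0// => l lj.
by rewrite AA (negPf lj) mul0r.
Qed.

End Trace.
End Frames.
(** * First and second variation of the k-scalar curvature *)

(** Both conclusions come from small explicit t: of sign opposite to a, where
    a t dominates, and then of both signs, where the cubic terms cancel. *)
Lemma quartic_ge0 (R : realFieldType) (a b c d : R) :
  (forall t, 0 <= a * t + b * t ^+ 2 + c * t ^+ 3 + d * t ^+ 4) ->
  a = 0 /\ 0 <= b.
Proof.
move=> P.
pose K := `|b| + `|c| + `|d| + 1.
have K1 : 1 <= K by rewrite /K lerDr !addr_ge0.
have bnd t : 0 <= t -> t <= 1 -> b * t ^+ 2 + c * t ^+ 3 + d * t ^+ 4 <= K * t ^+ 2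
  /\ b * t ^+ 2 - c * t ^+ 3 + d * t ^+ 4 <= K * t ^+ 2.
  move=> t0 t1.
  have t2 : 0 <= t ^+ 2 by rewrite sqr_ge0.
  have t32 : t ^+ 3 <= t ^+ 2 by rewrite ler_wiXn2l.
  have t42 : t ^+ 4 <= t ^+ 2 by rewrite ler_wiXn2l.
  have t3 : 0 <= t ^+ 3 by rewrite exprn_ge0.
  have t4 : 0 <= t ^+ 4 by rewrite exprn_ge0.
  have := ler_norm b; have := ler_norm c; have := ler_norm (- c).
  have := ler_norm d; have := normr_ge0 d; have := normr_ge0 c.
  by rewrite /K normrN; split; nra.
have a0 : a = 0.
  apply/eqP; rewrite -normr_le0 leNgt; apply/negP => a0.
  (* At t = - a * s, |t| <= 1 and the remainder is at most K t ^ 2, which is less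
     than half of |a t|. *)
  pose s := (`|a| + 2 * K)^-1.
  have D0 : 0 < `|a| + 2 * K by lra.
  have s0 : 0 < s by rewrite invr_gt0.
  have sE : s * (`|a| + 2 * K) = 1 by rewrite mulVf// gt_eqF.
  have t0 : 0 <= `|a| * s by rewrite mulr_ge0 ?ltW.
  have t1 : `|a| * s <= 1 by nra.
  have [b1 b2] := bnd _ t0 t1.
  have Ks : K * s < 1 by nra.
  have as0 : 0 < `|a| ^+ 2 * s by rewrite mulr_gt0// exprn_gt0.
  have [aN|aP] := ltrP a 0.
    have := P (`|a| * s); move: b1; rewrite (ltr0_norm aN) in as0 *; nra.
  have := P (- (`|a| * s)); move: b2; rewrite (ger0_norm aP) in as0 *; nra.
split=> //; rewrite leNgt; apply/negP => b0.
pose s := - b * (2 * (`|d| - b))^-1.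
have dd := normr_ge0 d.
have D0 : 0 < 2 * (`|d| - b) by lra.
have sE : s * (2 * (`|d| - b)) = - b by rewrite /s -mulrA mulVf ?mulr1// gt_eqF.
have s0 : 0 < s by rewrite /s mulr_gt0 ?invr_gt0//; lra.
have s1 : s <= 1 by nra.
have {}P : 0 <= b * s ^+ 2 + d * s ^+ 4.
  by have := P s; have := P (- s); rewrite a0; nra.
have : 0 <= b + d * s ^+ 2.
  have s2 : 0 < s ^+ 2 by rewrite exprn_gt0.
  have sd : s ^+ 2 * (b + d * s ^+ 2) = b * s ^+ 2 + d * s ^+ 4 by ring.
  by rewrite -(pmulr_rge0 _ s2) sd.
have s2s : s ^+ 2 <= s by rewrite expr2; nra.
have := ler_norm d; nra.
Qed.

Section ComplexParts.
Context {R : realType}.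
Implicit Types x y : Cx R.

Lemma ReD x y : complex.Re (x + y) = complex.Re x + complex.Re y.
Proof. by case: x y => [a b] []. Qed.

Lemma ReN x : complex.Re (- x) = - complex.Re x.
Proof. by case: x. Qed.

Lemma ImD x y : complex.Im (x + y) = complex.Im x + complex.Im y.
Proof. by case: x y => [a b] []. Qed.

Lemma ReM x y : complex.Re (x * y) =
  complex.Re x * complex.Re y - complex.Im x * complex.Im y.
Proof. by case: x y => [a b] []. Qed.

Lemma ImM x y : complex.Im (x * y) =
  complex.Re x * complex.Im y + complex.Im x * complex.Re y.
Proof. by case: x y => [a b] []. Qed.

Lemma ReJ x : complex.Re x^* = complex.Re x.
Proof. by case: x. Qed.

Lemma ImJ x : complex.Im x^* = - complex.Im x.
Proof. by case: x. Qed.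

Lemma complex_eq x y :
  complex.Re x = complex.Re y -> complex.Im x = complex.Im y -> x = y.
Proof. by case: x y => [a b] [c d] /= -> ->. Qed.

End ComplexParts.

Section Variation.
Context {R : realType} {V : lmodType (Cx R)}.
Local Notation C := (Cx R).

(** For an orthonormal e, the k-scalar curvature of its span. *)
Definition k_scalar (Q : V -> V -> V -> V -> C) k (e : 'I_k -> V) : C :=
  \sum_i \sum_j Q (e i) (e i) (e j) (e j).

Context {Q : V -> V -> V -> V -> C} (QK : kahler_tensor Q).
Context {g : V -> V -> C} (gP : inner_product g).
Context {k : nat} {e : 'I_k -> V} (eo : orthonormal g e).

Definition replace_vec (m : 'I_k) (X : V) i := if i == m then X else e i.

Lemma k_scalar_replace m X :
  k_scalar Q (replace_vec m X) = Q X X X X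
    + 2 * \sum_(j | j != m) Q X X (e j) (e j)
    + \sum_(i | i != m) \sum_(j | j != m) Q (e i) (e i) (e j) (e j).
Proof.
have rm : replace_vec m X m = X by rewrite /replace_vec eqxx.
have rN j : j != m -> replace_vec m X j = e j by rewrite /replace_vec => /negPf ->.
have inner Y : \sum_j Q Y Y (replace_vec m X j) (replace_vec m X j)
    = Q X X Y Y + \sum_(j | j != m) Q Y Y (e j) (e j).
  rewrite (bigD1 m)//= rm (kt_swap QK); congr (_ + _).
  by apply: eq_bigr => j /rN ->.
rewrite /k_scalar (bigD1 m)//= inner rm.
rewrite [X in _ + X](eq_bigr (fun i => Q X X (e i) (e i)
  + \sum_(j | j != m) Q (e i) (e i) (e j) (e j))); last first.
  by move=> i /rN ->; exact: inner.
by rewrite big_split/=; ring.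
Qed.

Lemma orthonormal_replace m X : g X X = 1 -> (forall j, j != m -> g X (e j) = 0) ->
  orthonormal g (replace_vec m X).
Proof.
move=> X1 Xe i j; rewrite /replace_vec.
have [->|im] := eqVneq i m.
  by have [|jm] := eqVneq j m; rewrite ?X1// Xe.
have [->|jm] := eqVneq j m; last exact: eo.
by rewrite -(ip_conj gP) Xe// rmorph0 (negPf im).
Qed.

(** The new frame replaces e m by (e m + t F) / sqrt N; the factor N ^+ 2 clears
    the denominators N ^+ 2 and N produced by the quartic and the quadratic
    occurrences of e m in the k-scalar curvature. *)
Lemma k_scalar_variation m F (t : C) : (forall j, g F (e j) = 0) -> t^* = t ->
  let p := g F F in let N := 1 + t ^+ 2 * p in
  let B X Y := \sum_(j | j != m) Q X Y (e j) (e j) in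
  let X := e m in
  exists e' : 'I_k -> V, orthonormal g e' /\
  N ^+ 2 * (k_scalar Q e' - k_scalar Q e) =
    t * (2 * (Q F X X X + Q X F X X) + 2 * (B F X + B X F))
    + t ^+ 2 * (4 * Q F F X X + Q F X F X + Q X F X F
                - 2 * p * Q X X X X + 2 * B F F - 2 * p * B X X)
    + t ^+ 3 * (2 * (Q F F F X + Q F F X F) + 2 * p * (B F X + B X F))
    + t ^+ 4 * (Q F F F F - p ^+ 2 * Q X X X X + 2 * p * B F F
                - 2 * p ^+ 2 * B X X).
Proof.
move=> Fe tR p N B X.
have N0 : 0 < N.
  rewrite ltr_pwDl// mulr_ge0 ?(ip_ge0 gP)// real_exprn_even_ge0//.
  exact/CrealP.
(* r is the normalizing factor of e m + t F, whose squared norm is N. *)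
pose r := (sqrtC N)^-1.
have rr : r ^+ 2 * N = 1 by rewrite exprVn sqrtCK mulVf// gt_eqF.
have rR : r^* = r.
  by apply/CrealP/ger0_real; rewrite invr_ge0 sqrtC_ge0 ltW.
pose Y := X + t *: F.
have gXX : g X X = 1 by rewrite eo eqxx.
have gXF : g X F = 0 by apply/eqP; rewrite (ip_eq0 gP) Fe.
have Yr : g (r *: Y) (r *: Y) = 1.
  rewrite -rr !(ipDl gP, ipDr gP, ipZl gP, ipZr gP) rR tR gXX gXF Fe /N /p.
  by ring.
exists (replace_vec m (r *: Y)); split.
  apply: orthonormal_replace => // j jm.
  by rewrite !(ipDl gP, ipDr gP, ipZl gP, ipZr gP) Fe eo eq_sym (negPf jm) /= !(mulr0, addr0).
have eE : k_scalar Q e = k_scalar Q (replace_vec m X).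
  apply: eq_bigr => i _; apply: eq_bigr => j _; rewrite /replace_vec /X.
  by case: eqVneq => [->|_]; case: eqVneq => [->|].
have BY : \sum_(j | j != m) Q (r *: Y) (r *: Y) (e j) (e j)
    = r ^+ 2 * (B X X + t * (B F X + B X F) + t ^+ 2 * B F F).
  rewrite /B !mulr_sumr -!big_split/= !mulr_sumr -!big_split/= mulr_sumr.
  apply: eq_bigr => j _; rewrite /Y.
  rewrite !(kt_add1 QK, kt_add2 QK, kt_scale1 QK, kt_scale2 QK) rR tR.
  by ring.
have QY : Q (r *: Y) (r *: Y) (r *: Y) (r *: Y) = r ^+ 4 * Q Y Y Y Y.
  rewrite !(kt_scale1 QK, kt_scale2 QK, kt_scale3 QK, kt_scale4 QK) rR.
  by ring.
rewrite eE !k_scalar_replace -/(B X X) BY QY (kt_quartic QK _ _ tR).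
set S := \sum_(i | _) _.
set q := (X in r ^+ 4 * X); set b := (X in r ^+ 2 * X).
transitivity ((r ^+ 2 * N) ^+ 2 * q + 2 * N * ((r ^+ 2 * N) * b)
   - N ^+ 2 * (Q X X X X + 2 * B X X)); first by ring.
by rewrite rr /q /b /N; ring.
Qed.

Hypothesis emin : forall e' : 'I_k -> V, orthonormal g e' ->
  complex.Re (k_scalar Q e) <= complex.Re (k_scalar Q e').

(** On the span of e, this is the k-Ricci curvature, polarized. *)
Definition ric_form X Y := \sum_j Q X Y (e j) (e j).

Lemma ric_form_conj X Y : (ric_form X Y)^* = ric_form Y X.
Proof.
by rewrite rmorph_sum/=; apply: eq_bigr => j _; exact: (kt_conj QK).
Qed.

(** The linear and quadratic coefficients of [k_scalar_variation], of which
    minimality makes the first vanish and the second nonnegative. *)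
Lemma real_variation m F : (forall j, g F (e j) = 0) ->
  complex.Re (ric_form F (e m)) = 0 /\
  0 <= complex.Re (2 * Q F F (e m) (e m) + 2 * ric_form F F
         - 2 * g F F * ric_form (e m) (e m)
         + (Q F (e m) F (e m) + Q (e m) F (e m) F)).
Proof.
move=> Fe; set X := e m; pose p := g F F.
pose B X Y := \sum_(j | j != m) Q X Y (e j) (e j).
have ricB Y Z : ric_form Y Z = Q Y Z X X + B Y Z by rewrite /ric_form (bigD1 m).
set c2 := (X in 0 <= complex.Re X).
pose c1 := ric_form F X + ric_form X F.
pose c3 := 2 * (Q F F F X + Q F F X F) + 2 * p * (B F X + B X F).
pose c4 := Q F F F F - p ^+ 2 * Q X X X X + 2 * p * B F F - 2 * p ^+ 2 * B X X.
have P (t : R) : 0 <= complex.Re (2 * c1) * t + complex.Re c2 * t ^+ 2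
    + complex.Re c3 * t ^+ 3 + complex.Re c4 * t ^+ 4.
  pose tc : C := t%:C%C.
  have tcR : tc^* = tc by apply: complex_eq; rewrite ?ImJ ?ReJ//= oppr0.
  have [e' [/emin le_e]] := k_scalar_variation m Fe tcR.
  rewrite -/p -/(B F X) -/(B X F) -/(B F F) -/(B X X) -/X -/c3 -/c4.
  set N := 1 + _; have NR : N \is Num.real.
    by rewrite realD// realM ?realX//; [exact/CrealP|exact/CrealP/(ip_real gP)].
  have -> : 4 * Q F F X X + Q F X F X + Q X F X F - 2 * p * Q X X X X
      + 2 * B F F - 2 * p * B X X = c2.
    by rewrite /c2 !ricB -/p; ring.
  have -> : 2 * (Q F X X X + Q X F X X) + 2 * (B F X + B X F) = 2 * c1.
    by rewrite /c1 !ricB; ring.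
  have tX i : tc ^+ i = (t ^+ i)%:C%C by rewrite rmorphXn.
  have Rt i z : complex.Re (tc ^+ i * z : C) = complex.Re z * t ^+ i.
    by rewrite tX ReM/= mul0r subr0 mulrC.
  move/(congr1 (@complex.Re R)); rewrite 3!ReD -[tc * _]/(tc ^+ 1 * _) !Rt expr1.
  set lhs := complex.Re _; move=> E.
  apply: (@le_trans _ _ lhs); last by rewrite E.
  have /complex_realP[s sE] : N ^+ 2 \is Num.real by rewrite realX.
  have s0 : 0 <= s by rewrite -ler0c -sE -realEsqr.
  rewrite /lhs sE ReM /= mul0r subr0 mulr_ge0// ReD ReN; lra.
have [a0 b0] := quartic_ge0 P; split=> //.
move: a0; rewrite /c1 -[ric_form X F]ric_form_conj mulr_natl mulr2n !ReD ReJ.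
lra.
Qed.
End Variation.
(** * Positivity at a minimal frame *)

Section MinimalFrame.
Context {R : realType} {V : lmodType (Cx R)}.
Local Notation C := (Cx R).
Context {Q : V -> V -> V -> V -> C} (QK : kahler_tensor Q).
Context {g : V -> V -> C} (gP : inner_product g).
Context {k : nat} {e : 'I_k -> V} (eo : orthonormal g e).
Hypothesis emin : forall e' : 'I_k -> V, orthonormal g e' ->
  complex.Re (k_scalar Q e) <= complex.Re (k_scalar Q e').
Local Notation ric := (@ric_form R V Q k e).

Lemma ric_formDl X Y Z : ric (X + Y) Z = ric X Z + ric Y Z.
Proof.
by rewrite -big_split/=; apply: eq_bigr => j _; rewrite (kt_add1 QK).
Qed.

Lemma ric_formZl a X Z : ric (a *: X) Z = a * ric X Z.
Proof.
by rewrite mulr_sumr; apply: eq_bigr => j _; rewrite (kt_scale1 QK).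
Qed.

Lemma ric_formDr X Y Z : ric Z (X + Y) = ric Z X + ric Z Y.
Proof. by rewrite -(ric_form_conj QK) ric_formDl rmorphD/= !(ric_form_conj QK). Qed.

Lemma ric_formZr a X Z : ric Z (a *: X) = a^* * ric Z X.
Proof. by rewrite -(ric_form_conj QK) ric_formZl rmorphM/= (ric_form_conj QK). Qed.

Lemma ric_form0r X : ric X 0 = 0.
Proof. by rewrite -(scale0r X) ric_formZr rmorph0 mul0r. Qed.

Lemma Re_iM (z : C) : complex.Re ('i * z) = - complex.Im z.
Proof. by rewrite -complexiE ReM/= mul0r mul1r sub0r. Qed.

(** The variations along F and i F control the real and the imaginary part. *)
Lemma ric_form_cross m F : (forall j, g F (e j) = 0) -> ric F (e m) = 0.
Proof.
move=> Fe; have [F0 _] := real_variation QK gP eo emin m Fe.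
have iFe j : g ('i *: F) (e j) = 0 by rewrite (ipZl gP) Fe mulr0.
have [+ _] := real_variation QK gP eo emin m iFe.
rewrite ric_formZl Re_iM => /eqP; rewrite oppr_eq0 => /eqP iF0.
exact: complex_eq.
Qed.

(** Half the average of the second variations along F and i F; the terms
    Q F (e m) F (e m) and their conjugates change sign between the two. *)
Lemma ric_form_second m F : (forall j, g F (e j) = 0) ->
  0 <= Q F F (e m) (e m) + ric F F - g F F * ric (e m) (e m).
Proof.
move=> Fe; set z := (X in 0 <= X).
have zR : z^* = z.
  rewrite /z rmorphB rmorphD rmorphM/= (kt_conj QK) (ip_conj gP).
  by rewrite !(ric_form_conj QK).
have iFe j : g ('i *: F) (e j) = 0 by rewrite (ipZl gP) Fe mulr0.
have [_ b1] := real_variation QK gP eo emin m Fe.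
have [_] := real_variation QK gP eo emin m iFe.
rewrite !ric_formZl !ric_formZr (ipZl gP) (ipZr gP).
rewrite !(kt_scale1 QK, kt_scale2 QK, kt_scale3 QK, kt_scale4 QK) conjCi.
have i2 : 'i * 'i = -1 :> C by rewrite -expr2 sqrCi.
have ii (x : C) : 'i * (- 'i * x) = x by rewrite mulrA mulrN i2 opprK mul1r.
have ii' (x : C) : - 'i * ('i * x) = x by rewrite mulrA mulNr i2 opprK mul1r.
have iI (x : C) : 'i * ('i * x) = - x by rewrite mulrA i2 mulN1r.
have iN (x : C) : - 'i * (- 'i * x) = - x.
  by rewrite mulrA mulrNN i2 mulN1r.
rewrite !(ii, ii', iI, iN) => b2.
have zE : (complex.Re z)%:C%C = z by apply/RRe_real/CrealP.
rewrite -zE ler0c -(pmulrn_lge0 _ (ltn0Sn 3)).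
rewrite (_ : _ *+ 4 = complex.Re (z *+ 4)); last by rewrite !mulrS !ReD mulr0n addr0.
have -> : z *+ 4 = (2 * Q F F (e m) (e m) + 2 * ric F F
      - 2 * g F F * ric (e m) (e m) + (Q F (e m) F (e m) + Q (e m) F (e m) F))
    + (2 * Q F F (e m) (e m) + 2 * ric F F
      - 2 * g F F * ric (e m) (e m) + (- Q F (e m) F (e m) - Q (e m) F (e m) F)).
  by rewrite /z; ring.
by rewrite ReD addr_ge0.
Qed.

(** The sum of [ric_form_second] over m: sum_m Q F F (e m) (e m) is once more
    ric F F, so that it occurs k + 1 times. *)
Lemma ric_form_orthogonal F : (forall j, g F (e j) = 0) ->
  g F F * k_scalar Q e <= ric F F *+ k.+1.
Proof.
move=> Fe; rewrite -subr_ge0.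
rewrite (_ : _ - _ =
    \sum_m (Q F F (e m) (e m) + ric F F - g F F * ric (e m) (e m))).
  by apply: sumr_ge0 => m _; exact: ric_form_second.
rewrite sumrB big_split/= -mulr_sumr; congr (_ - _).
by rewrite sumr_const card_ord mulrS.
Qed.

Lemma minimal_frame_pos : (0 < k)%N ->
  (forall c : 'I_k -> C, \sum_i c i *: e i != 0 ->
    0 < ric (\sum_i c i *: e i) (\sum_i c i *: e i)) ->
  forall u, u != 0 -> 0 < \sum_i Q (e i) (e i) u u.
Proof.
move=> k0 ricP u u0.
have -> : \sum_i Q (e i) (e i) u u = ric u u.
  by apply: eq_bigr => i _; exact: kt_swap.
pose P := proj (g := g) e u; pose F := u - P.
have Fe j : g F (e j) = 0 by exact: (proj_orthogonal gP).
have FP : ric F P = 0.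
  rewrite /P /proj; elim/big_ind: _ => [|X Y X0 Y0|i _].
  - by rewrite ric_form0r.
  - by rewrite ric_formDr X0 Y0 addr0.
  - by rewrite ric_formZr ric_form_cross// mulr0.
have PF : ric P F = 0 by rewrite -(ric_form_conj QK) FP rmorph0.
have uE : u = P + F by rewrite addrC subrK.
have ricPP : P != 0 -> 0 < ric P P := ricP (fun i => g u (e i)).
clearbody F.
have ricE : ric u u = ric P P + ric F F.
  by rewrite {1 2}uE !(ric_formDl, ric_formDr) FP PF addr0 add0r.
have [F0|F0] := eqVneq F 0.
  by rewrite ricE F0 ric_form0r addr0; apply: ricPP; move: u0;
    rewrite {1}uE F0 addr0.
have P_ge0 : 0 <= ric P P.
  have [->|P0] := eqVneq P 0; last exact/ltW/ricPP.
  by rewrite ric_form0r.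
rewrite ricE ltr_wpDl// -(pmulrn_lgt0 _ (ltn0Sn k)).
apply: lt_le_trans (ric_form_orthogonal Fe).
rewrite mulr_gt0//; first exact: (ip_pos gP).
have eric (m : 'I_k) : 0 < ric (e m) (e m).
  pose c i : C := (i == m)%:R.
  have ce : \sum_i c i *: e i = e m.
    rewrite (bigD1 m)//= big1 ?addr0 /c ?eqxx ?scale1r// => i /negPf ->.
    by rewrite scale0r.
  by rewrite -ce; apply: ricP; rewrite ce; exact: orthonormal_neq0 eo.
rewrite /k_scalar (bigD1 (Ordinal k0))//= ltr_pwDl//; first exact: eric.
by apply: sumr_ge0 => i _; exact/ltW/eric.
Qed.

End MinimalFrame.
(** * Existence of a minimal frame *)

Section ComplexContinuity.
Context {R : realType}.
Local Notation C := (Cx R).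

Lemma Re_continuous : continuous (fun z : C => complex.Re z).
Proof.
move=> z; have zF : Filter (nbhs (z : C)) by exact: nbhs_filter.
apply/cvgrPdist_lt => e e0.
have : nbhs z (ball z (e%:C%C : C)) by apply: nbhsx_ballx; rewrite ltcR.
apply: filterS => w; rewrite -ball_normE/= => zw.
rewrite -ReN -ReD -ltcR; apply: le_lt_trans zw; exact: normc_ge_Re.
Qed.

Lemma Im_continuous : continuous (fun z : C => complex.Im z).
Proof.
rewrite (_ : (fun z : C => complex.Im z) = fun z : C => complex.Re (- 'i * z)).
  move=> z; apply: (@continuous_comp _ _ _ (fun w : C => - 'i * w) (fun z : C => complex.Re z)).
    exact: mulrl_continuous.
  exact: Re_continuous.
by apply/funext => z; rewrite mulNr ReN -complexiE ReM/= mul0r mul1r sub0r opprK.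
Qed.

Lemma real_complex_continuous : continuous (fun t : R => t%:C%C : C).
Proof.
move=> t; apply/cvgrPdist_lt => e e0.
have eE : e = (complex.Re e)%:C%C by rewrite RRe_real// gtr0_real.
have : nbhs t (ball t (complex.Re e)) by apply: nbhsx_ballx; rewrite -ltcR -eE.
apply: filterS => w; rewrite -ball_normE/= => tw.
rewrite -rmorphB/= normc_def/= expr0n/= addr0 sqrtr_sqr.
by rewrite eE ltcR.
Qed.

Lemma complexEi (z : C) : z = (complex.Re z)%:C%C + 'i * (complex.Im z)%:C%C.
Proof. by rewrite -complexiE -complexE. Qed.

End ComplexContinuity.
Section ContinuousComplexFunctions.
Context {R : realType} {T : topologicalType}.
Local Notation C := (Cx R).
Implicit Types f g : T -> C.

Lemma continuous_complexD f g :
  continuous f -> continuous g -> continuous (fun x => f x + g x).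
Proof. by move=> cf cg x; apply: cvgD; [exact: cf|exact: cg]. Qed.

Lemma continuous_complexM f g :
  continuous f -> continuous g -> continuous (fun x => f x * g x).
Proof. by move=> cf cg x; apply: cvgM; [exact: cf|exact: cg]. Qed.

Lemma continuous_complexZ (a : C) f :
  continuous f -> continuous (fun x => a * f x).
Proof.
move=> cf; apply: (continuous_complexM (f := fun=> a) _ cf) => x.
exact: cvg_cst.
Qed.

Lemma continuous_complexZr (a : C) f :
  continuous f -> continuous (fun x => f x * a).
Proof.
move=> cf; apply: (continuous_complexM (g := fun=> a) cf) => x.
exact: cvg_cst.
Qed.

Lemma continuous_real_complex (h : T -> R) :
  continuous h -> continuous (fun x => (h x)%:C%C : C).
Proof.
by move=> ch x; apply: (continuous_comp (ch x)); exact: real_complex_continuous.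
Qed.

Lemma continuous_complex_sum I (r : seq I) (F : I -> T -> C) :
  (forall i, continuous (F i)) -> continuous (fun x => \sum_(i <- r) F i x).
Proof.
move=> cF; elim: r => [|i r IH] x.
  under eq_fun do rewrite big_nil; exact: cvg_cst.
under eq_fun do rewrite big_cons; apply: cvgD; [exact: cF|exact: IH].
Qed.

Lemma continuous_conj f : continuous f -> continuous (fun x => (f x)^*).
Proof.
move=> cf; have cRe : continuous (fun x => complex.Re (f x)).
  move=> x; apply: (continuous_comp (cf x)); exact: Re_continuous.
have cIm : continuous (fun x => complex.Im (f x)).
  move=> x; apply: (continuous_comp (cf x)); exact: Im_continuous.
rewrite (_ : (fun x => _) = fun x =>
    (complex.Re (f x))%:C%C + (- 'i) * (complex.Im (f x))%:C%C :> C).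
  apply: continuous_complexD; last apply: continuous_complexZ.
    exact: continuous_real_complex.
  exact: continuous_real_complex.
apply/funext => x; rewrite [LHS]complexEi ReJ ImJ.
by rewrite rmorphN mulrN mulNr.
Qed.

End ContinuousComplexFunctions.

Section MinimalFrameExists.
Context {R : realType} {n : nat}.
Local Notation C := (Cx R).
Local Notation V := 'rV[C]_n.
Context {g : V -> V -> C} (gP : inner_product g).

Lemma ip_row (X Y : V) : g X Y = \sum_a X 0 a * g (delta_mx 0 a) Y.
Proof.
rewrite {1}(row_sum_delta X) (ip_suml gP); apply: eq_bigr => a _.
exact: (ipZl gP).
Qed.

Lemma ip_coord (X Y : V) : g X Y = \sum_a \sum_b
  X 0 a * (Y 0 b)^* * g (delta_mx 0 a) (delta_mx 0 b).
Proof.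
rewrite ip_row; apply: eq_bigr => a _.
rewrite -(ip_conj gP) {1}(row_sum_delta Y) (ip_suml gP) rmorph_sum/=.
rewrite mulr_sumr; apply: eq_bigr => b _.
by rewrite (ipZl gP) rmorphM/= (ip_conj gP) mulrA.
Qed.

(** The k conditions on v are linear, with a coefficient matrix of rank at most
    k < n. *)
Lemma exists_orthogonal k (e : 'I_k -> V) : (k < n)%N ->
  exists2 v, v != 0 & forall i, g v (e i) = 0.
Proof.
move=> kn; pose A : 'M[C]_(n, k) := \matrix_(a, i) g (delta_mx 0 a) (e i).
have : kermx A != 0.
  rewrite -mxrank_eq0 mxrank_ker subn_eq0 -ltnNge.
  by apply: leq_ltn_trans kn; exact: rank_leq_col.
move=> /rowV0Pn[v /sub_kermxP vA v0]; exists v => // i.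
have /rowP/(_ i) := vA; rewrite !mxE => vAi.
by rewrite ip_row -[RHS]vAi; apply: eq_bigr => a _; rewrite mxE.
Qed.

Lemma exists_orthonormal k : (k <= n)%N ->
  exists e : 'I_k -> V, orthonormal g e.
Proof.
elim: k => [_|k IH kn]; first by exists (fun=> 0) => -[].
have [e eo] := IH (ltnW kn).
have [v v0 ve] := exists_orthogonal e kn.
pose r := (sqrtC (g v v))^-1.
have rR : r^* = r.
  by apply/CrealP/ger0_real; rewrite invr_ge0 sqrtC_ge0 (ip_ge0 gP).
have rv1 : g (r *: v) (r *: v) = 1.
  rewrite (ipZl gP) (ipZr gP) rR mulrA -expr2 exprVn sqrtCK mulVf//.
  by rewrite gt_eqF// (ip_pos gP).
exists (fun i => if unlift ord0 i is Some j then e j else r *: v) => i j.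
case: (unliftP ord0 i) => [i' ->|->]; case: (unliftP ord0 j) => [j' ->|->].
- by rewrite eo (inj_eq lift_inj).
- by rewrite (ipZr gP) -(ip_conj gP) ve rmorph0 mulr0.
- by rewrite (ipZl gP) ve mulr0.
- by rewrite rv1 eqxx.
Qed.

(** Expand v in an orthonormal basis f of the whole space: the coefficients
    g v (f i) have modulus at most 1, by the Bessel inequality for the single
    unit vector v. *)
Lemma ip_coord_bound : exists K : R, forall (v : V) a, g v v = 1 ->
  `|complex.Re (v 0 a)| <= K /\ `|complex.Im (v 0 a)| <= K.
Proof.
have [f fo] := exists_orthonormal (leqnn n).
pose A : 'M[C]_n := \matrix_(i, a) f i 0 a.
pose B : 'M[C]_n := \matrix_(a, i) g (delta_mx 0 a) (f i).
have AB : A *m B = 1%:M.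
  apply/matrixP => i j; rewrite !mxE -fo ip_row.
  by apply: eq_bigr => a _; rewrite !mxE.
pose K : C := \sum_a \sum_i `|f i 0 a|.
have K_real : (complex.Re K)%:C%C = K.
  apply/RRe_real/ger0_real; apply: sumr_ge0 => a _; exact: sumr_ge0.
(* K is the sum of all moduli, so that it bounds every coordinate at once. *)
exists (complex.Re K) => v a v1.
have va : `|v 0 a| <= K.
  have -> : v 0 a = \sum_i g v (f i) * f i 0 a.
    have /rowP/(_ a) : v = v *m B *m A by rewrite -mulmxA (mulmx1C AB) mulmx1.
    rewrite mxE => ->; apply: eq_bigr => i _; rewrite !mxE ip_row; congr (_ * _).
    by apply: eq_bigr => b _; rewrite mxE.
  apply: le_trans (ler_norm_sum _ _ _) _.
  rewrite /K [leRHS](bigD1 a)//= ler_wpDr//.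
    by apply: sumr_ge0 => b _; exact: sumr_ge0.
  apply: ler_sum => i _; rewrite normrM ler_piMl//.
  rewrite -(@expr_le1 _ 2)//; apply: le_trans (bessel1 gP _ v1) _.
  by rewrite fo eqxx.
split; rewrite -lecR K_real; apply: le_trans va.
  exact: normc_ge_Re.
by have := normc_ge_Re ('i * v 0 a); rewrite Re_iM normrN normrM normCi mul1r.
Qed.

(** Real coordinates of a frame, so that compactness is the Heine-Borel property
    of real row vectors; the boolean selects the real part
    (false) or the imaginary part (true) of coordinate a of vector i. *)
Definition coord_index k : finType := ('I_k * 'I_n * bool)%type.

Definition frame_of k (w : 'rV[R]_#|coord_index k|) (i : 'I_k) : V :=
  \row_a ((w 0 (enum_rank ((i, a, false) : coord_index k)))%:C%C
     + 'i * (w 0 (enum_rank ((i, a, true) : coord_index k)))%:C%C).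

Definition coords_of k (e : 'I_k -> V) : 'rV[R]_#|coord_index k| :=
  \row_j let: (i, a, b) := enum_val j in
    if b then complex.Im (e i 0 a) else complex.Re (e i 0 a).

Lemma coords_ofK k (e : 'I_k -> V) : frame_of (coords_of e) = e.
Proof.
by apply/funext => i; apply/rowP => a; rewrite !mxE !enum_rankK -complexEi.
Qed.

Lemma frame_of_continuous k (i : 'I_k) a :
  continuous (fun w : 'rV[R]_#|coord_index k| => frame_of w i 0 a).
Proof.
rewrite (_ : (fun w => _) = fun w : 'rV[R]_#|coord_index k| =>
  (w 0 (enum_rank ((i, a, false) : coord_index k)))%:C%C
    + 'i * (w 0 (enum_rank ((i, a, true) : coord_index k)))%:C%C : C).
  apply: continuous_complexD; last apply: continuous_complexZ.
    apply: continuous_real_complex; exact: coord_continuous.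
  apply: continuous_real_complex; exact: coord_continuous.
by apply/funext => w; rewrite mxE.
Qed.

Lemma ip_frame_continuous k (i j : 'I_k) :
  continuous (fun w : 'rV[R]_#|coord_index k| =>
    g (frame_of w i) (frame_of w j)).
Proof.
under eq_fun do rewrite ip_coord.
apply: continuous_complex_sum => a; apply: continuous_complex_sum => b.
apply: continuous_complexZr.
apply: continuous_complexM; first exact: frame_of_continuous.
apply: continuous_conj; exact: frame_of_continuous.
Qed.

Lemma compact_orthonormal k :
  compact [set w : 'rV[R]_#|coord_index k| | orthonormal g (frame_of w)].
Proof.
have [K bK] := ip_coord_bound.
have cB : compact [set w : 'rV[R]_#|coord_index k| |
    forall j, `[- K, K]%classic (w ord0 j)].
  apply: (@rV_compact R _ (fun=> `[- K, K]%classic)) => j.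
  exact: segment_compact.
apply: subclosed_compact cB _.
- rewrite (_ : [set w | _] = \bigcap_(ij in [set: 'I_k * 'I_k])
      [set w | g (frame_of w ij.1) (frame_of w ij.2) = (ij.1 == ij.2)%:R]).
    apply: closed_bigI => -[i j] _ /=.
    have /continuous_closedP cl := @ip_frame_continuous k i j.
    have c1 : closed [set ((i == j)%:R : C)].
      by apply/accessible_closed_set1/hausdorff_accessible; exact: norm_hausdorff.
    exact: cl c1.
  by apply/seteqP; split=> [w wo [i j] _|w wo i j] /=; [exact: wo|exact: (wo (i, j) I)].
- move=> w wo j /=; rewrite in_itv/= -ler_norml.
  have [[[i a] b] jE] : exists t : coord_index k, j = enum_rank t.
    by exists (enum_val j); rewrite enum_valK.
  have := bK (frame_of w i) a; rewrite wo eqxx => /(_ erefl).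
  rewrite mxE ReD ImD Re_iM.
  rewrite (_ : complex.Im ('i * _) = w 0 (enum_rank ((i, a, true) : coord_index k))).
    by rewrite /= oppr0 addr0 add0r => -[]; rewrite jE; case: b {jE}.
  by rewrite -complexiE ImM/= mul0r mul1r add0r.
Qed.

Context {Q : V -> V -> V -> V -> C} (QK : kahler_tensor Q).

Lemma kt_coord X Y Z W : Q X Y Z W = \sum_a \sum_b \sum_c \sum_d
  X 0 a * (Y 0 b)^* * Z 0 c * (W 0 d)^* *
  Q (delta_mx 0 a) (delta_mx 0 b) (delta_mx 0 c) (delta_mx 0 d).
Proof.
rewrite {1}(row_sum_delta X) (kt_suml QK); apply: eq_bigr => a _.
rewrite {1}(row_sum_delta Y) (kt_sumr QK); apply: eq_bigr => b _.
rewrite (kt_swap QK) {1}(row_sum_delta Z) (kt_suml QK); apply: eq_bigr => c _.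
rewrite {1}(row_sum_delta W) (kt_sumr QK); apply: eq_bigr => d _.
rewrite (kt_scale1 QK) (kt_scale2 QK) (kt_scale3 QK) (kt_scale4 QK).
by rewrite (kt_swap QK) !mulrA; ring.
Qed.

Lemma k_scalar_continuous k :
  continuous (fun w : 'rV[R]_#|coord_index k| => k_scalar Q (frame_of w)).
Proof.
apply: continuous_complex_sum => i; apply: continuous_complex_sum => j.
under eq_fun do rewrite kt_coord.
do 4![apply: continuous_complex_sum => ?].
have cx := @frame_of_continuous k.
have cJ i' a : continuous (fun w => (@frame_of k w i' 0 a)^*).
  by apply: continuous_conj; exact: cx.
apply: continuous_complexZr.
apply: continuous_complexM; last exact: cJ.
apply: continuous_complexM; last exact: cx.
by apply: continuous_complexM; [exact: cx|exact: cJ].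
Qed.

Lemma exists_minimal_frame k : (k <= n)%N ->
  exists2 e : 'I_k -> V, orthonormal g e &
    forall e' : 'I_k -> V, orthonormal g e' ->
      complex.Re (k_scalar Q e) <= complex.Re (k_scalar Q e').
Proof.
move=> kn; have [e0 e0o] := exists_orthonormal kn.
have ne : [set w | orthonormal g (@frame_of k w)] !=set0.
  by exists (coords_of e0) => /=; rewrite coords_ofK.
have cS : continuous (fun w : 'rV[R]_#|coord_index k| =>
    complex.Re (k_scalar Q (frame_of w))).
  move=> w; apply: (continuous_comp (k_scalar_continuous (x := w))).
  exact: Re_continuous.
have [w] := EVT_min_rV ne (@compact_orthonormal k) (continuous_subspaceT cS).
rewrite inE => wo wmin; exists (frame_of w) => // e' e'o.
by have := wmin (coords_of e'); rewrite inE/= coords_ofK; exact.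
Qed.

End MinimalFrameExists.
(** * Real directional derivatives and the symmetry of second derivatives *)

(** Two applications of the mean value theorem, in s and then in t.  Exchanging
    the roles of s and t leaves the second difference unchanged, which relates
    the two mixed derivatives. *)
Lemma second_difference (R : realType) (G Gs Gst : R -> R -> R) (d h : R) :
    0 < h -> h < d ->
    (forall s t : R, `|s| < d -> `|t| < d -> is_derive s 1 (G ^~ t) (Gs s t)) ->
    (forall s t : R, `|s| < d -> `|t| < d -> is_derive t 1 (Gs s) (Gst s t)) ->
  exists s t, [/\ `|s| < h, `|t| < h &
    G h h - G h 0 - (G 0 h - G 0 0) = Gst s t * h * h].
Proof.
move=> h0 hd dG dGs.
have inner x : x \in `[0, h]%R -> `|x| < d.
  by rewrite in_itv/= => /andP[x0 xh]; rewrite ger0_norm// (le_lt_trans xh).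
have hi : `|h| < d by rewrite gtr0_norm.
have zi : `|0 : R| < d by rewrite normr0 (lt_trans h0).
have oo x : x \in `]0, h[%R -> x \in `[0, h]%R.
  exact: subset_itv_oo_cc.
have dphi s : s \in `[0, h]%R -> is_derive s 1 (fun s => G s h - G s 0) (Gs s h - Gs s 0).
  move=> /inner si; have := dG _ _ si hi; have := dG _ _ si zi => ? ?.
  exact: is_deriveB.
have [s sI sE] := MVT h0 (fun x xi => dphi x (oo x xi))
  (derivable_within_continuous (fun x xi => @ex_derive _ _ _ _ _ _ _ (dphi x xi))).
have si := inner _ (oo _ sI).
have dGs' t : t \in `[0, h]%R -> is_derive t 1 (Gs s) (Gst s t).
  by move=> /inner; exact: dGs.
have [t tI tE] := MVT h0 (fun x xi => dGs' x (oo x xi))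
  (derivable_within_continuous (fun x xi => @ex_derive _ _ _ _ _ _ _ (dGs' x xi))).
exists s, t; split.
- by move: sI; rewrite in_itv/= => /andP[s0 sh]; rewrite gtr0_norm.
- by move: tI; rewrite in_itv/= => /andP[t0 th]; rewrite gtr0_norm.
by rewrite sE tE subr0.
Qed.


Lemma near_eq_is_derive (R : numFieldType) (V W : normedModType R)
    (f g : V -> W) (a v : V) (df : W) :
  (\near a, f a = g a) -> is_derive a v f df -> is_derive a v g df.
Proof.
move=> fg [dff <-]; apply: DeriveDef; first exact: near_eq_derivable dff.
apply/esym; exact: near_eq_derive.
Qed.

Section RealDerivatives.
Context {R : realType} {n : nat}.
Local Notation C := (Cx R).
Local Notation V := 'rV[C]_n.
Implicit Types (f g : V -> C) (z v w : V) (U : set V).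

Lemma line0 z v : line z v 0 = z.
Proof. by rewrite /line scale0r addr0. Qed.

Lemma lineD z v s t : line z v (s + t) = line (line z v s) v t.
Proof. by rewrite /line rmorphD scalerDl addrA. Qed.

Lemma lineC z v w s t : line (line z v s) w t = line (line z w t) v s.
Proof. by rewrite /line addrAC. Qed.

Lemma nbhs_plane z v w (A : set V) : nbhs z A ->
  exists2 d : R, 0 < d &
    forall s t : R, `|s| < d -> `|t| < d -> A (line (line z v s) w t).
Proof.
move=> zA; pose p (st : R * R) : V := line (line z v st.1) w st.2.
have cs u (h : R * R -> R) : continuous h ->
    continuous (fun st => ((h st)%:C%C : C) *: u : V).
  move=> ch st; apply: (@continuous_comp _ _ _ (fun st => (h st)%:C%C : C)
      (fun a : C => a *: u)); last exact: scalel_continuous.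
  exact: (continuous_real_complex ch).
have cp : continuous p.
  move=> st; apply: cvgD; last by apply: cs => ?; exact: cvg_snd.
  by apply: cvgD; [exact: cvg_cst|apply: cs => ?; exact: cvg_fst].
have p0 : p (0, 0) = z by rewrite /p !line0.
have : nbhs (0, 0) (p @^-1` A) by apply: cp; rewrite p0.
move=> /nbhs_ballP[d /= d0 dA]; exists d => // s t sd td.
by apply: (dA (s, t)); split; rewrite /= -ball_normE/= sub0r normrN.
Qed.

Lemma nbhs_line z v (A : set V) : nbhs z A -> \forall t \near (0 : R), A (line z v t).
Proof.
move=> /(nbhs_plane v v)[d d0 dA]; apply/nbhs_ballP; exists d => //= t.
rewrite -ball_normE/= sub0r normrN => td.
by rewrite -[line z v t](@line0 _ v); apply: (dA t 0) => //; rewrite normr0.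
Qed.

(** Relational form of [rderivable] and [rderive], which composes better. *)
Definition is_rderive f v z (df : C) : Prop :=
  is_derive (0 : R) (1 : R) (fun t : R => complex.Re (f (line z v t))) (complex.Re df) /\
  is_derive (0 : R) (1 : R) (fun t : R => complex.Im (f (line z v t))) (complex.Im df).

Lemma is_rderiveP f v z df :
  is_rderive f v z df -> rderivable f v z /\ rderive f v z = df.
Proof.
case=> [[dR eR] [dI eI]]; split; first exact: (conj dR dI).
by rewrite /rderive eR eI; case: df {dR eR dI eI}.
Qed.

Lemma rderivableP f v z : rderivable f v z -> is_rderive f v z (rderive f v z).
Proof.
by case=> dR dI; exact: (conj (DeriveDef dR erefl) (DeriveDef dI erefl)).
Qed.

Lemma near_is_rderive f g v z df : (\near z, f z = g z) ->
  is_rderive f v z df -> is_rderive g v z df.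
Proof.
move=> /(nbhs_line v) fg [dR dI]; split.
  by apply: near_eq_is_derive dR; apply: filterS fg => t ->.
by apply: near_eq_is_derive dI; apply: filterS fg => t ->.
Qed.

Lemma near_rderivable f g v z : (\near z, f z = g z) ->
  rderivable f v z -> rderivable g v z.
Proof.
by move=> fg /rderivableP/(near_is_rderive fg)/is_rderiveP[].
Qed.

Lemma near_rderive f g v z : (\near z, f z = g z) ->
  rderivable f v z -> rderive g v z = rderive f v z.
Proof.
by move=> fg /rderivableP/(near_is_rderive fg)/is_rderiveP[].
Qed.

Lemma is_rderive_cst (c : C) v z : is_rderive (fun=> c) v z 0.
Proof. by split; exact: is_derive_cst. Qed.

Lemma is_rderiveD f g v z df dg :
  is_rderive f v z df -> is_rderive g v z dg ->
  is_rderive (fun z => f z + g z) v z (df + dg).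
Proof.
move=> [fR fI] [gR gI]; split.
  by under eq_fun do rewrite ReD; rewrite ReD; exact: is_deriveD.
by under eq_fun do rewrite ImD; rewrite ImD; exact: is_deriveD.
Qed.

Lemma is_rderiveM f g v z df dg :
  is_rderive f v z df -> is_rderive g v z dg ->
  is_rderive (fun z => f z * g z) v z (df * g z + f z * dg).
Proof.
move=> [fR fI] [gR gI]; split.
  under eq_fun do rewrite ReM.
  apply: (is_derive_eq (is_deriveB (is_deriveM fR gR) (is_deriveM fI gI))).
  by rewrite !line0 /GRing.scale/= ReD !ReM; ring.
under eq_fun do rewrite ImM.
apply: (is_derive_eq (is_deriveD (is_deriveM fR gI) (is_deriveM fI gR))).
by rewrite !line0 /GRing.scale/= ImD !ImM; ring.
Qed.

Lemma is_rderiveZ (a : C) f v z df :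
  is_rderive f v z df -> is_rderive (fun z => a * f z) v z (a * df).
Proof.
move=> fd; have := is_rderiveM (is_rderive_cst a v z) fd.
by rewrite mul0r add0r.
Qed.

Lemma is_rderive_conj f v z df :
  is_rderive f v z df -> is_rderive (fun z => (f z)^*) v z df^*.
Proof.
move=> [fR fI]; split.
  by under eq_fun do rewrite ReJ; rewrite ReJ.
by under eq_fun do rewrite ImJ; rewrite ImJ; exact: is_deriveN.
Qed.

Lemma is_rderive_sum I (r : seq I) (F : I -> V -> C) v z (dF : I -> C) :
  (forall i, is_rderive (F i) v z (dF i)) ->
  is_rderive (fun z => \sum_(i <- r) F i z) v z (\sum_(i <- r) dF i).
Proof.
move=> dFi; elim: r => [|i r IH].
  by under eq_fun do rewrite big_nil; rewrite big_nil; exact: is_rderive_cst.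
by under eq_fun do rewrite big_cons; rewrite big_cons; exact: is_rderiveD.
Qed.

Lemma rderivable_prod I (r : seq I) (F : I -> V -> C) v z :
  (forall i, rderivable (F i) v z) ->
  rderivable (fun z => \prod_(i <- r) F i z) v z.
Proof.
move=> dFi; elim: r => [|i r /rderivableP IH].
  under eq_fun do rewrite big_nil.
  by case: (is_rderiveP (is_rderive_cst 1 v z)).
under eq_fun do rewrite big_cons.
by case: (is_rderiveP (is_rderiveM (rderivableP (dFi i)) IH)).
Qed.

Lemma rderivableM f g v z : rderivable f v z -> rderivable g v z ->
  rderivable (fun z => f z * g z) v z.
Proof.
by move=> /rderivableP df /rderivableP dg; case: (is_rderiveP (is_rderiveM df dg)).
Qed.

Lemma rderivable_sum I (r : seq I) (F : I -> V -> C) v z :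
  (forall i, rderivable (F i) v z) ->
  rderivable (fun z => \sum_(i <- r) F i z) v z.
Proof.
move=> dF.
by case: (is_rderiveP (is_rderive_sum r (fun i => rderivableP (dF i)))).
Qed.

Lemma rderivable_cst (c : C) v z : rderivable (fun=> c) v z.
Proof. by case: (is_rderiveP (is_rderive_cst c v z)). Qed.

(** 1 / w = (Re w - i Im w) / (Re w ^ 2 + Im w ^ 2), so only a real function has
    to be inverted. *)
Lemma rderivableV f v z : f z != 0 -> rderivable f v z ->
  rderivable (fun z => (f z)^-1) v z.
Proof.
move=> fz0 [dR dI].
pose a (t : R) := complex.Re (f (line z v t)).
pose b (t : R) := complex.Im (f (line z v t)).
pose N := a * a + b * b.
have dN : derivable (fun t => (N t)^-1) (0 : R) (1 : R).
  apply: derivableV; last exact: (derivableD (derivableM dR dR) (derivableM dI dI)).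
  have -> : N 0 = complex.Re (f z) ^+ 2 + complex.Im (f z) ^+ 2.
    by rewrite /N /a /b !fctE line0 !expr2.
  by rewrite -(inj_eq (@complexI R)) add_Re2_Im2 sqrf_eq0 normr_eq0.
have ReV (x : C) : complex.Re x^-1 =
    complex.Re x * (complex.Re x * complex.Re x + complex.Im x * complex.Im x)^-1.
  by case: x => c d /=; rewrite !expr2.
have ImV (x : C) : complex.Im x^-1 =
    - complex.Im x * (complex.Re x * complex.Re x + complex.Im x * complex.Im x)^-1.
  by case: x => c d /=; rewrite !expr2 mulNr.
split; first by under eq_fun do rewrite ReV; exact: (derivableM dR dN).
by under eq_fun do rewrite ImV; exact: (derivableM (derivableN dI) dN).
Qed.

End RealDerivatives.
Lemma half_distances (R : realFieldType) (a b a' b' : R) :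
  `|a - a'| < `|a - b| / 2 -> `|b - b'| < `|a - b| / 2 -> a' <> b'.
Proof.
move=> A B ab; suff : `|a - b| < `|a - b| by rewrite ltxx.
rewrite {1}(_ : a - b = (a - a') - (b - b')); last by rewrite ab; ring.
by apply: le_lt_trans (ler_normB _ _) _; rewrite [ltRHS]splitr ltrD.
Qed.

Lemma is_derive_translate (R : realType) (phi : R -> R) (t d : R) :
  is_derive (0 : R) (1 : R) (fun s : R => phi (t + s)) d ->
  is_derive t (1 : R) phi d.
Proof.
have E : (fun h : R => h^-1 *: (((fun s : R => phi (t + s)) \o shift 0) (h *: (1 : R))
    - phi (t + 0))) = (fun h => h^-1 *: ((phi \o shift t) (h *: (1 : R)) - phi t)).
  by apply/funext => h /=; rewrite !addr0 [t + _]addrC.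
case=> dphi <-; apply: DeriveDef; first by rewrite /derivable -E.
by rewrite /derive -E.
Qed.

Section SecondDerivatives.
Context {R : realType} {n : nat}.
Local Notation C := (Cx R).
Local Notation V := 'rV[C]_n.
Implicit Types (f g : V -> C) (z v w X Y : V) (U : set V).

(** P stands for the real or the imaginary part.  If the two mixed derivatives
    differed at z by e > 0, choose a parallelogram around z on which each stays
    within e / 2 of its value at z; its second difference, computed in both
    orders, gives points where they coincide, which [half_distances] forbids. *)
Lemma rderive_comm_part (P : C -> R) U f z v w :
    (forall g u x, rderivable g u x ->
      is_derive (0 : R) (1 : R) (fun t : R => P (g (line x u t))) (P (rderive g u x))) ->
    continuous P ->
    open U -> rsmooth 2 U f -> U z ->
  P (rderive (rderive f v) w z) = P (rderive (rderive f w) v z).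
Proof.
move=> dP cP Uo [_ sf] Uz.
have along g u x (t : R) : rderivable g u (line x u t) ->
    is_derive t (1 : R) (fun s : R => P (g (line x u s))) (P (rderive g u (line x u t))).
  move=> dg; have := dP g u _ dg.
  rewrite (_ : (fun s => _) = (fun s => P (g (line x u (t + s))))).
    exact: is_derive_translate.
  by apply/funext => s; rewrite lineD.
have mixed v1 w1 (p : R -> R -> V) (d h : R) :
    (forall s t, p s t = line (line z v1 s) w1 t) -> 0 < h -> h < d ->
    (forall s t : R, `|s| < d -> `|t| < d -> U (p s t)) ->
    exists s t, [/\ `|s| < h, `|t| < h &
      P (f (p h h)) - P (f (p h 0)) - (P (f (p 0 h)) - P (f (p 0 0)))
      = P (rderive (rderive f v1) w1 (p s t)) * h * h].
  move=> pE h0 hd dU.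
  have d1 (s t : R) : `|s| < d -> `|t| < d ->
      is_derive s (1 : R) (fun s => P (f (p s t))) (P (rderive f v1 (p s t))).
    move=> sd td; have := along f v1 (line z w1 t) s.
    rewrite -lineC -pE => /(_ ((sf v1).1 _ (dU _ _ sd td))).
    rewrite (_ : (fun s => _) = fun s => P (f (p s t)))//.
    by apply/funext => s'; rewrite pE lineC.
  have d2 (s t : R) : `|s| < d -> `|t| < d ->
      is_derive t (1 : R) (fun t => P (rderive f v1 (p s t)))
        (P (rderive (rderive f v1) w1 (p s t))).
    move=> sd td; have := along (rderive f v1) w1 (line z v1 s) t.
    rewrite -pE => /(_ (((sf v1).2.2 w1).1 _ (dU s t sd td))).
    rewrite (_ : (fun s => _) = fun t => P (rderive f v1 (p s t)))//.
    by apply/funext => t'; rewrite pE.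
  exact: (second_difference h0 hd d1 d2).
apply/eqP; rewrite -subr_eq0 -normr_le0 leNgt; apply/negP => e0.
set e := `|_| in e0.
have near_z g : {for z, continuous g} ->
    \forall x \near z, `|P (g z) - P (g x)| < e / 2.
  move=> cg; have cPg : {for z, continuous (P \o g)}.
    by apply: continuous_comp; [exact: cg|exact: cP].
  have : nbhs (P (g z)) (ball (P (g z)) (e / 2)).
    by apply: nbhsx_ballx; rewrite divr_gt0.
  move=> /cPg; apply: (@filterS _ (nbhs z) (nbhs_filter z)) => x.
  by rewrite /= -ball_normE.
have cvw : {for z, continuous (rderive (rderive f v) w)}.
  exact: (((sf v).2.2 w).2.1 z Uz).
have cwv : {for z, continuous (rderive (rderive f w) v)}.
  exact: (((sf w).2.2 v).2.1 z Uz).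
have Un : nbhs z U by exact: open_nbhs_nbhs.
have [d d0 dA] := nbhs_plane v w (filterI Un (filterI (near_z _ cvw) (near_z _ cwv))).
have h0 : 0 < d / 2 by rewrite divr_gt0.
have hd : d / 2 < d by rewrite ltr_pdivrMr// ltr_pMr// ltr1n.
pose p (s t : R) := line (line z v s) w t.
have dU (s t : R) : `|s| < d -> `|t| < d -> U (p s t).
  by move=> sd td; exact: (dA s t sd td).1.
have [s1 [t1 [sh th E1]]] := mixed v w p d (d / 2) (fun=> fun=> erefl) h0 hd dU.
have [s2 [t2 [sh' th' E2]]] := mixed w v (fun s t => p t s) d (d / 2)
  (fun s t => lineC z v w t s) h0 hd (fun s t sd td => dU t s td sd).
have [_ [A _]] := dA s1 t1 (lt_trans sh hd) (lt_trans th hd).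
have [_ [_ B]] := dA t2 s2 (lt_trans th' hd) (lt_trans sh' hd).
have swap (a b c c' : R) : a - b - (c - c') = a - c - (b - c') by ring.
have d20 : d / 2 != 0 by rewrite gt_eqF.
have ab := mulIf d20 (mulIf d20 (etrans (esym E1) (etrans (swap _ _ _ _) E2))).
exact: (half_distances A B ab).
Qed.

Lemma rderive_comm U f z v w : open U -> rsmooth 2 U f -> U z ->
  rderive (rderive f v) w z = rderive (rderive f w) v z.
Proof.
move=> Uo sf Uz; apply: complex_eq.
  apply: (@rderive_comm_part (fun c : C => complex.Re c) U f z v w) => //.
    by move=> g u x /rderivableP[].
  exact: Re_continuous.
apply: (@rderive_comm_part (fun c : C => complex.Im c) U f z v w) => //.
  by move=> g u x /rderivableP[].
exact: Im_continuous.
Qed.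

End SecondDerivatives.
(** * The operators del and delbar *)

Section DelCalculus.
Context {R : realType} {n : nat}.
Local Notation C := (Cx R).
Local Notation V := 'rV[C]_n.
Implicit Types (f g : V -> C) (z X Y : V) (U : set V).

(** [del] and [delbar] in a direction v involve the real derivatives along v
    and 'i *: v. *)
Definition rderivable_at f z := forall v, rderivable f v z.

Lemma near_del f g X z : (\near z, f z = g z) -> rderivable_at f z ->
  del X g z = del X f z.
Proof. by move=> fg df; rewrite /del !(near_rderive fg). Qed.

Lemma near_delbar f g Y z : (\near z, f z = g z) -> rderivable_at f z ->
  delbar Y g z = delbar Y f z.
Proof. by move=> fg df; rewrite /delbar !(near_rderive fg). Qed.

Lemma rderiveE f v z df : is_rderive f v z df -> rderive f v z = df.
Proof. by case/is_rderiveP. Qed.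

Lemma del_cst (c : C) X z : del X (fun=> c) z = 0.
Proof. by rewrite /del !(rderiveE (is_rderive_cst _ _ _)) mulr0 subr0 mul0r. Qed.

Lemma delbar_cst (c : C) Y z : delbar Y (fun=> c) z = 0.
Proof. by rewrite /delbar !(rderiveE (is_rderive_cst _ _ _)) mulr0 addr0 mul0r. Qed.

Lemma delbar_sum I (r : seq I) (F : I -> V -> C) Y z :
  (forall i, rderivable_at (F i) z) ->
  delbar Y (fun w => \sum_(i <- r) F i w) z = \sum_(i <- r) delbar Y (F i) z.
Proof.
move=> dF; have dFv v := rderiveE (is_rderive_sum r (fun i => rderivableP (dF i v))).
by rewrite /delbar !dFv mulr_sumr -big_split/= mulr_suml.
Qed.

Lemma delbarM f g Y z : rderivable_at f z -> rderivable_at g z ->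
  delbar Y (fun w => f w * g w) z = delbar Y f z * g z + f z * delbar Y g z.
Proof.
move=> df dg.
have dfg v := rderiveE (is_rderiveM (rderivableP (df v)) (rderivableP (dg v))).
have comb (a b c d e e' : C) : (a * b + c * d + 'i * (e * b + c * e')) / 2
    = (a + 'i * e) / 2 * b + c * ((d + 'i * e') / 2) by ring.
by rewrite /delbar (dfg Y) (dfg ('i *: Y)) comb.
Qed.

Lemma delbar_conj f Y z : rderivable_at f z ->
  delbar Y (fun w => (f w)^*) z = (del Y f z)^*.
Proof.
move=> df; have dfv v := rderiveE (is_rderive_conj (rderivableP (df v))).
rewrite /delbar /del !dfv rmorphM/= rmorphB/= rmorphM/= conjCi fmorphV/= rmorph_nat.
by rewrite mulNr opprK.
Qed.

Lemma del_conj f X z : rderivable_at f z ->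
  del X (fun w => (f w)^*) z = (delbar X f z)^*.
Proof.
move=> df; have dfv v := rderiveE (is_rderive_conj (rderivableP (df v))).
rewrite /delbar /del !dfv rmorphM/= rmorphD/= rmorphM/= conjCi fmorphV/= rmorph_nat.
by rewrite mulNr.
Qed.

Lemma rsmooth1 U f : rsmooth 2 U f -> forall z, U z -> rderivable_at f z.
Proof. by move=> [_ sf] z Uz v; exact: (sf v).1. Qed.

Lemma rsmooth2 U f v : rsmooth 2 U f -> forall z, U z -> rderivable_at (rderive f v) z.
Proof. by move=> [_ sf] z Uz w; exact: (((sf v).2.2 w).1 z Uz). Qed.

Lemma is_rderive_del U f X z v : rsmooth 2 U f -> U z ->
  is_rderive (del X f) v z
    ((rderive (rderive f X) v z - 'i * rderive (rderive f ('i *: X)) v z) / 2).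
Proof.
move=> sf Uz.
have d1 := rderivableP (rsmooth2 X sf Uz v).
have d2 := rderivableP (rsmooth2 ('i *: X) sf Uz v).
have comb (a b : C) : 2^-1 * a + - 'i / 2 * b = (a - 'i * b) / 2 by ring.
have -> : del X f = fun w => 2^-1 * rderive f X w + - 'i / 2 * rderive f ('i *: X) w.
  by apply/funext => w; rewrite comb.
rewrite -comb; exact: (is_rderiveD (is_rderiveZ _ d1) (is_rderiveZ _ d2)).
Qed.

Lemma is_rderive_delbar U f Y z v : rsmooth 2 U f -> U z ->
  is_rderive (delbar Y f) v z
    ((rderive (rderive f Y) v z + 'i * rderive (rderive f ('i *: Y)) v z) / 2).
Proof.
move=> sf Uz.
have d1 := rderivableP (rsmooth2 Y sf Uz v).
have d2 := rderivableP (rsmooth2 ('i *: Y) sf Uz v).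
have comb (a b : C) : 2^-1 * a + 'i / 2 * b = (a + 'i * b) / 2 by ring.
have -> : delbar Y f = fun w => 2^-1 * rderive f Y w + 'i / 2 * rderive f ('i *: Y) w.
  by apply/funext => w; rewrite comb.
rewrite -comb; exact: (is_rderiveD (is_rderiveZ _ d1) (is_rderiveZ _ d2)).
Qed.

Lemma rderivable_del U f X z : rsmooth 2 U f -> U z -> rderivable_at (del X f) z.
Proof. by move=> sf Uz v; case: (is_rderiveP (is_rderive_del X v sf Uz)). Qed.

Lemma rderivable_delbar U f Y z :
  rsmooth 2 U f -> U z -> rderivable_at (delbar Y f) z.
Proof. by move=> sf Uz v; case: (is_rderiveP (is_rderive_delbar Y v sf Uz)). Qed.

Lemma del_delbar_comm U f X Y z : open U -> rsmooth 2 U f -> U z ->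
  del Y (delbar X f) z = delbar X (del Y f) z.
Proof.
move=> Uo sf Uz; rewrite /del /delbar -/(delbar X f) -/(del Y f).
rewrite !(rderiveE (is_rderive_delbar _ _ sf Uz)).
rewrite !(rderiveE (is_rderive_del _ _ sf Uz)).
have comm v w := rderive_comm v w Uo sf Uz.
move: ('i *: X) ('i *: Y) => X' Y'.
(* Expanding both sides gives the same four second derivatives, with the two
   directions in opposite orders. *)
have comb (a b c d a' b' c' d' : C) : a = a' -> b = b' -> c = c' -> d = d' ->
    ((a + 'i * b) / 2 - 'i * ((c + 'i * d) / 2)) / 2
    = ((a' - 'i * c') / 2 + 'i * ((b' - 'i * d') / 2)) / 2.
  by move=> -> -> -> ->; ring.
exact: (comb _ _ _ _ _ _ _ _ (comm X Y) (comm X' Y) (comm X Y') (comm X' Y')).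
Qed.

Lemma rderivable_det m (A : V -> 'M[C]_m) v z :
  (forall i j, rderivable (fun w => A w i j) v z) ->
  rderivable (fun w => \det (A w)) v z.
Proof.
move=> dA; apply: rderivable_sum => s; apply: rderivableM.
  exact: rderivable_cst.
by apply: rderivable_prod => i; exact: dA.
Qed.

(** By Cramer's rule, entries of the inverse are polynomials in the entries of
    A divided by the determinant. *)
Lemma rderivable_invmx m (A : V -> 'M[C]_m) v z i j :
  (\near z, A z \in unitmx) ->
  (forall i j, rderivable (fun w => A w i j) v z) ->
  rderivable (fun w => invmx (A w) i j) v z.
Proof.
move=> Au dA.
apply: (@near_rderivable _ _ (fun w => (\det (A w))^-1 * cofactor (A w) j i)).
  by apply: filterS Au => w wu; rewrite /invmx wu !mxE.
apply: rderivableM.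
  apply: rderivableV; last exact: rderivable_det.
  by have := nbhs_singleton Au; rewrite unitmxE unitfE.
apply: rderivableM; first exact: rderivable_cst.
apply: rderivable_det => i' j'.
by under eq_fun do rewrite !mxE; exact: dA.
Qed.

Lemma delbar_mxM p q r (A : V -> 'M[C]_(p, q)) (B : V -> 'M[C]_(q, r)) Y z :
  (forall i j, rderivable_at (fun w => A w i j) z) ->
  (forall i j, rderivable_at (fun w => B w i j) z) ->
  delbar_mx Y (fun w => A w *m B w) z =
    delbar_mx Y A z *m B z + A z *m delbar_mx Y B z.
Proof.
move=> dA dB; apply/matrixP => i j; rewrite !mxE.
under eq_fun do rewrite mxE.
rewrite delbar_sum => [|l v]; last exact: rderivableM (dA i l v) (dB l j v).
rewrite -big_split/=; apply: eq_bigr => l _.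
by rewrite delbarM// !mxE.
Qed.

Lemma delbar_mx_cst p q (A : 'M[C]_(p, q)) Y z : delbar_mx Y (fun=> A) z = 0.
Proof. by apply/matrixP => i j; rewrite !mxE delbar_cst. Qed.

Lemma del_mx_cst p q (A : 'M[C]_(p, q)) X z : del_mx X (fun=> A) z = 0.
Proof. by apply/matrixP => i j; rewrite !mxE del_cst. Qed.

End DelCalculus.
(** * Hermitian symmetry of the Chern curvature *)

Section ChernCurvature.
Context {R : realType} {n r : nat}.
Local Notation C := (Cx R).
Local Notation V := 'rV[C]_n.
Implicit Types X Y : V.
Context {U : set V} {h : V -> 'M[C]_r} {z : V}.
Hypothesis Uo : open U.
Hypothesis Uz : U z.
Hypothesis h_smooth : forall i j, rsmooth 2 U (fun w => h w i j).
Hypothesis h_herm : forall w, U w -> (h w)^t* = h w.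
Hypothesis h_unit : forall w, U w -> h w \in unitmx.

Lemma adjointM p q s (A : 'M[C]_(p, q)) (B : 'M[C]_(q, s)) :
  (A *m B)^t* = B^t* *m A^t*.
Proof. by rewrite trmx_mul map_mxM. Qed.

Lemma adjointK p q (A : 'M[C]_(p, q)) : A^t*^t* = A.
Proof. by apply/matrixP => i j; rewrite !mxE conjCK. Qed.

Lemma adjointB p q (A B : 'M[C]_(p, q)) : (A - B)^t* = A^t* - B^t*.
Proof. by rewrite raddfB/= map_mxB. Qed.

Lemma adjointE p q (A : 'M[C]_(p, q)) i j : (A^t*) i j = (A j i)^*.
Proof. by rewrite !mxE. Qed.

Lemma del_mxE p q X (A : V -> 'M[C]_(p, q)) w i j :
  del_mx X A w i j = del X (fun w => A w i j) w.
Proof. exact: mxE. Qed.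

Lemma delbar_mxE p q Y (A : V -> 'M[C]_(p, q)) w i j :
  delbar_mx Y A w i j = delbar Y (fun w => A w i j) w.
Proof. exact: mxE. Qed.

Lemma near_U : \near z, U z.
Proof. exact: open_nbhs_nbhs. Qed.

Lemma rderivable_chern_form X i j :
  rderivable_at (fun w => chern_form h X w i j) z.
Proof.
move=> v; under eq_fun do rewrite mxE.
apply: rderivable_sum => l; apply: rderivableM.
  under eq_fun do rewrite mxE.
  exact: (rderivable_del X (h_smooth i l) Uz).
apply: rderivable_invmx => [|a b]; first exact: filterS near_U.
exact: (rsmooth1 (h_smooth a b) Uz).
Qed.

(** Minus the curvature of the Chern connection, with its vector index lowered
    by h. *)
Definition chern_matrix X Y : 'M[C]_r :=
  delbar_mx Y (del_mx X h) z - del_mx X h z *m invmx (h z) *m delbar_mx Y h z.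

(** Differentiate theta_X h = del_X h by the product rule, which avoids
    differentiating the inverse of h. *)
Lemma delbar_chern_form X Y :
  delbar_mx Y (chern_form h X) z *m h z = chern_matrix X Y.
Proof.
have dh i j : rderivable_at (fun w => h w i j) z by exact: (rsmooth1 (h_smooth i j) Uz).
have E : delbar_mx Y (fun w => chern_form h X w *m h w) z =
    delbar_mx Y (del_mx X h) z.
  apply/matrixP => i j; rewrite [LHS]mxE [RHS]mxE.
  apply: near_delbar.
    by apply: filterS near_U => w Uw; rewrite /chern_form mulmxKV// h_unit.
  under eq_fun do rewrite mxE.
  exact: (rderivable_del X (h_smooth i j) Uz).
rewrite /chern_matrix -E (delbar_mxM Y (rderivable_chern_form X) dh).
by rewrite /chern_form addrK.
Qed.

(** A section with constant coefficients is holomorphic, so only the derivative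
    of the connection form survives. *)
Lemma chern_curvature_mul X Y u :
  chern_curvature h X Y u z *m h z = - (u *m chern_matrix X Y).
Proof.
have nb0 : nablabar Y (cst u) = (fun=> 0) :> (V -> 'rV[C]_r).
  by apply/funext => w; exact: delbar_mx_cst.
have na : nabla h X (cst u) = (fun w => u *m chern_form h X w).
  by apply/funext => w; rewrite /nabla del_mx_cst add0r.
rewrite /chern_curvature nb0 na {1}/nabla del_mx_cst mul0mx addr0 sub0r.
rewrite /nablabar delbar_mxM; last exact: rderivable_chern_form.
  by rewrite delbar_mx_cst mul0mx add0r mulNmx -mulmxA delbar_chern_form.
by move=> i j v; exact: rderivable_cst.
Qed.

Lemma del_mx_adjoint X : (del_mx X h z)^t* = delbar_mx X h z.
Proof.
apply/matrixP => i j; rewrite !mxE.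
rewrite -(delbar_conj X (rsmooth1 (h_smooth j i) Uz)).
apply: near_delbar; last exact: (rsmooth1 (h_smooth i j) Uz).
by apply: filterS near_U => w /h_herm/matrixP/(_ i j); rewrite !mxE.
Qed.

Lemma delbar_mx_adjoint X : (delbar_mx X h z)^t* = del_mx X h z.
Proof. by rewrite -del_mx_adjoint adjointK. Qed.

(** Since h is Hermitian, conjugate transposition turns delbar_Y del_X h into
    del_Y delbar_X h, which is delbar_X del_Y h, and exchanges the outer factors
    of the quadratic term. *)
Lemma chern_matrix_adjoint X Y : (chern_matrix X Y)^t* = chern_matrix Y X.
Proof.
rewrite /chern_matrix adjointB; congr (_ - _).
  apply/matrixP => i j.
  rewrite adjointE.
  rewrite [in LHS]delbar_mxE.
  rewrite [in RHS]delbar_mxE.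
  have del_fun k l : (fun w => del_mx Y h w k l) = del Y (fun w => h w k l).
    by apply/funext => w; rewrite del_mxE.
  have del_fun' k l : (fun w => del_mx X h w k l) = del X (fun w => h w k l).
    by apply/funext => w; rewrite del_mxE.
  rewrite del_fun del_fun'.
  rewrite -(del_conj Y (rderivable_del X (h_smooth j i) Uz)).
  rewrite -(del_delbar_comm X Y Uo (h_smooth i j) Uz).
  apply: near_del; last exact: (rderivable_delbar X (h_smooth i j) Uz).
  apply: filterS near_U => w Uw.
  rewrite -(delbar_conj X (rsmooth1 (h_smooth j i) Uw)).
  apply/esym/near_delbar; last exact: (rsmooth1 (h_smooth i j) Uw).
  have : nbhs w U by exact: open_nbhs_nbhs.
  by apply: filterS => w' /h_herm/matrixP/(_ i j); rewrite !mxE.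
rewrite !adjointM delbar_mx_adjoint del_mx_adjoint mulmxA; congr (_ *m _ *m _).
by rewrite trmx_inv map_invmx h_herm.
Qed.

End ChernCurvature.
(** * The curvature tensor at a point *)

Section CurvatureTensor.
Context {R : realType} {n : nat} {M : complexManifold R n}.
Local Notation C := (Cx R).
Local Notation V := 'rV[C]_n.
Context (omega : hermMetric (tangentBundle M)) (x : M).

Lemma herm_linear (H : 'M[C]_n) a (X Y Z : V) :
  herm H (a *: X + Y) Z = a * herm H X Z + herm H Y Z.
Proof. by rewrite /herm !mulmxDl -!scalemxAl !mxE. Qed.

Lemma herm_conj (H : 'M[C]_n) (X Y : V) : (herm H X Y)^* = herm (H^t*) Y X.
Proof. by rewrite /herm -adjointE !adjointM adjointK mulmxA. Qed.

Lemma pos_def_unit (H : 'M[C]_n) :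
  (forall u, u != 0 -> 0 < herm H u u) -> H \in unitmx.
Proof.
move=> Hpos; rewrite -row_free_unit -kermx_eq0; apply/negPn/negP.
move=> /rowV0Pn[u /sub_kermxP uH /Hpos].
by rewrite /herm uH mul0mx mxE ltxx.
Qed.

Lemma metric_inner_product : inner_product (metric_at omega x).
Proof.
have dx := hb_at_dom (tangentBundle M) x.
split=> [a X Y Z|X Y|X]; first exact: herm_linear.
  by rewrite /metric_at herm_conj (hm_herm omega dx).
exact: (hm_pos omega dx).
Qed.

Let c := cm_at x.
Let h z : 'M[C]_n := hm_mx omega (c : hb_index (tangentBundle M)) (cm_inv c z).

Lemma curvatureE : exists K : V -> V -> 'M[C]_n,
  (forall X Y, (K X Y)^t* = K Y X) /\
  forall X Y u v, curvature omega x X Y u v = - herm (K X Y) u v.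
Proof.
pose A := @hb_dom _ _ _ _ (tangentBundle M) c.
pose U := cm_chart c @` (A `&` cm_dom c).
have Uo : open U by apply: open_chart_image; exact: cm_dom_open.
have cx : cm_dom c x := cm_at_dom x.
have Uz : U (cm_chart c x) by exists x.
have hs i j : rsmooth 2 U (fun z => h z i j) by exact: (hm_smooth omega).
have UA z : U z -> A (cm_inv c z) by move=> [y [Ay cy] <-]; rewrite cm_chartK.
have hh z : U z -> (h z)^t* = h z by move=> /UA; exact: hm_herm.
have hu z : U z -> h z \in unitmx.
  by move=> /UA Az; apply: pos_def_unit => u; exact: (hm_pos omega Az).
exists (chern_matrix (h := h) (z := cm_chart c x)); split=> [X Y|X Y u v].
  exact: (chern_matrix_adjoint Uo Uz hs hh).
have hx : hm_mx omega (c : hb_index (tangentBundle M)) x = h (cm_chart c x).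
  by rewrite /h cm_chartK.
rewrite /curvature /metric_at /herm -[hb_at _ x]/c hx.
by rewrite (chern_curvature_mul Uo Uz hs hu) mulNmx mxE.
Qed.

(** Of the three properties, linearity in the third argument and the Hermitian
    symmetry hold for every Hermitian metric. *)
Lemma curvature_kahler_tensor :
  chern_kahler_like omega -> kahler_tensor (curvature omega x).
Proof.
move=> ckl; have [K [KJ KE]] := curvatureE; split=> [X Y a Z Z' W|X Y Z W|].
- by rewrite !KE herm_linear opprD mulrN.
- by rewrite !KE rmorphN /= herm_conj KJ.
- exact: ckl.
Qed.

Lemma orthonormal_free k (e : 'I_k -> V) :
  orthonormal (metric_at omega x) e -> free [tuple e i | i < k].
Proof.
move=> eo; apply/freeP => a a0 i.
have : metric_at omega x (\sum_j a j *: e j) (e i) = a i.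
  rewrite (ip_suml metric_inner_product) (bigD1 i)//= big1 => [|j ji].
    by rewrite (ipZl metric_inner_product) eo eqxx mulr1 addr0.
  by rewrite (ipZl metric_inner_product) eo (negPf ji) mulr0.
move=> <-; rewrite (_ : \sum_j _ = 0) ?(ip0l metric_inner_product)//.
rewrite -[RHS]a0; apply: eq_bigr => j _.
by rewrite (nth_map j) ?size_enum_ord ?nth_ord_enum.
Qed.

(** Stated for an abstract Q so that it applies both to the curvature and to
    its opposite. *)
Lemma exists_RC_positive_subspace (Q : V -> V -> V -> V -> C) k :
    kahler_tensor Q -> (0 < k <= n)%N ->
    (forall (S : {vspace V}) (e : k.-tuple V), \dim S = k ->
      unitary_basis omega x S e -> forall X, X \in S -> X != 0 ->
      0 < \sum_(i < k) Q X X (tnth e i) (tnth e i)) ->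
  exists S : {vspace V}, \dim S = k /\
    forall e : k.-tuple V, unitary_basis omega x S e ->
    forall u, u != 0 -> 0 < \sum_(i < k) Q (tnth e i) (tnth e i) u u.
Proof.
move=> QK /andP[k0 kn] ricP.
have gP := metric_inner_product.
have [e eo emin] := exists_minimal_frame gP QK kn.
pose t := [tuple e i | i < k]; pose S := <<t>>%VS.
have tb : basis_of S t by rewrite /basis_of eqxx orthonormal_free.
have te i : tnth t i = e i by rewrite tnth_mktuple.
have tu : unitary_basis omega x S t.
  by split=> // i j; rewrite !te eo.
have dS : \dim S = k by rewrite (eqnP (orthonormal_free eo)) size_tuple.
exists S; split=> // e' [e'b e'o] u u0.
have eS (c' : 'I_k -> C) : \sum_i c' i *: e i \in S.
  apply: memv_suml => i _; apply: memvZ; rewrite -te.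
  by apply: memv_span; exact: mem_tnth.
have span i : exists c' : 'I_k -> C, tnth e' i = \sum_j c' j *: e j.
  exists (fun j => coord t j (tnth e' i)).
  have : tnth e' i \in S by rewrite -(span_basis e'b) memv_span// mem_tnth.
  move=> /(coord_basis tb) {1}->.
  by apply: eq_bigr => j _; rewrite -te -tnth_nth.
rewrite (trace_change_frame gP eo e'o span (B := fun X Y => Q X Y u u)).
- apply: (minimal_frame_pos QK gP eo emin k0) => // c' c0.
  have := ricP S t dS tu _ (eS c') c0.
  by under eq_bigr do rewrite te.
- by move=> a X Y Z; rewrite (kt_add1 QK) (kt_scale1 QK).
- by move=> a X Y Z; rewrite (kt_add2 QK) (kt_scale2 QK).
Qed.

End CurvatureTensor.

Theorem theorem2p7 (R : realType) (n : nat) (M : complexManifold R n)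
    (omega : hermMetric (tangentBundle M))
    (M_compact : compact [set: M])
    (omega_ckl : chern_kahler_like omega)
    (k : nat) (k_gt0 : (1 <= k)%N) (k_le_n : (k <= n)%N) :
  (ric_pos omega k -> uniformly_RC_pos omega omega k) /\
  (ric_neg omega k -> uniformly_RC_neg omega omega k).
Proof.
have kn : (0 < k <= n)%N by rewrite k_gt0.
split=> ricP x; have QK := curvature_kahler_tensor x omega_ckl.
  by apply: (exists_RC_positive_subspace QK kn) => S e dS eu; exact: ricP.
have ricN (S : {vspace 'rV[Cx R]_n}) (e : k.-tuple 'rV[Cx R]_n) : \dim S = k ->
    unitary_basis omega x S e -> forall X, X \in S -> X != 0 ->
    0 < \sum_(i < k) - curvature omega x X X (tnth e i) (tnth e i).
  by move=> dS eu X XS X0; rewrite sumrN oppr_gt0; exact: (ricP x S dS e eu X XS X0).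
have [S [dS SP]] := exists_RC_positive_subspace (kahler_tensorN QK) kn ricN.
exists S; split=> // e eu u u0.
by have := SP e eu u u0; rewrite sumrN oppr_gt0.
Qed.
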